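(* Let $c>3/2$ be a constant. There exists $d_0$ such that for every constant $d\ge d_0$ (independent of $n$) and every integer $q\geq \frac{cd}{\log d}$ the following holds. Let $G=G_{n,m}$ with $m=dn/2$, let $\Omega_q$ be the set of proper $q$-colorings of $G$, and let $H_q$ be the graph with vertex set $\Omega_q$ in which $\sigma,\tau$ are adjacent iff $h(\sigma,\tau)=1$. Then with high probability (as $n\to\infty$), $H_q$ contains a connected component containing $(1-o(1))|\Omega_q|$ of the colorings in $\Omega_q$.
   Context: $G_{n,m}$ denotes the uniformly random graph on vertex set $[n]=\{1,\dots,n\}$ with exactly $m$ edges. A proper $q$-coloring is a map $\sigma:[n]\to[q]$ such that $\sigma(u)\neq\sigma(v)$ for every edge $\{u,v\}$. For maps $\sigma,\tau:[n]\to[q]$, the Hamming distance is $h(\sigma,\tau)=|\{v\in[n]:\sigma(v)\neq\tau(v)\}|$. ''With high probability'' means with probability tending to $1$ as $n\to\infty$; $o(1)$ denotes a quantity tending to $0$ as $n\to\infty$. *)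

(* Defs.v *)
From mathcomp Require Import all_boot all_order all_algebra.
From mathcomp Require Import all_classical all_reals all_analysis.
Set Implicit Arguments.
Unset Strict Implicit.
Unset Printing Implicit Defensive.
Import Order.TTheory GRing.Theory Num.Theory.
Import numFieldNormedType.Exports.

(* A simple graph on the vertex set 'I_n is represented by its edge set
   E : {set {set 'I_n}}, all of whose elements have cardinality 2. *)
Definition graphs (n m : nat) : {set {set {set 'I_n}}} :=
  [set E : {set {set 'I_n}} | [forall e in E, #|e| == 2] && (#|E| == m)].

(* Probability of the event A for G_{n,m}, uniform on [graphs n m]; the value
   is 0 in the degenerate case 'C(n, 2) < m, when [graphs n m] is empty. *)
Definition prob_Gnm (R : realType) (n m : nat) (A : pred {set {set 'I_n}}) : R :=
  (#|[set E in graphs n m | A E]|%:R / #|graphs n m|%:R)%R.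
Arguments prob_Gnm R n m A : clear implicits.

Definition hamming (n q : nat) (s t : {ffun 'I_n -> 'I_q}) : nat :=
  #|[set v | s v != t v]|.

Definition proper_colorings (n q : nat) (E : {set {set 'I_n}}) :
    {set {ffun 'I_n -> 'I_q}} :=
  [set s : {ffun 'I_n -> 'I_q} |
    [forall u, forall v, ([set u; v] \in E) ==> (s u != s v)]].

Definition recolor_adj (n q : nat) (E : {set {set 'I_n}}) :
    rel {ffun 'I_n -> 'I_q} :=
  fun s t => [&& s \in proper_colorings q E, t \in proper_colorings q E
              & hamming s t == 1].

(* The vertex sets of the connected components of H_q. Each one is nonempty,
   so there is none when there is no proper q-coloring. *)
Definition recolor_components (n q : nat) (E : {set {set 'I_n}}) :
    {set {set {ffun 'I_n -> 'I_q}}} :=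
  equivalence_partition (connect (@recolor_adj n q E)) (proper_colorings q E).

Definition giant_component (R : realType) (n q : nat) (eps : R)
    (E : {set {set 'I_n}}) : bool :=
  [exists C in recolor_components q E,
    ((1 - eps) * #|proper_colorings q E|%:R <= #|C|%:R :> R)%R].

(* Main.v *)
(** With high probability all proper q-colourings of G are connected in H_q.

    Put g = d / log d. If disjoint sets A_1, ..., A_r have average size at most
    n / ((1 + eps) g) and W is a set of at least d^(-eps/8) n further vertices,
    then some w in W has no neighbour in some A_i: for a fixed configuration the
    failure probability is prod (1 - (1 - p)^|A_i|) over all w and i, which is
    at most exp (- |W| sum (1 - p)^|A_i|) <= exp (- n d^(eps/8) / (2 log d)), and
    this beats the (r + 2)^n configurations. Hence, starting from any colouring,
    greedily moving vertices into r prescribed colour classes leaves fewer than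
    d^(-eps/8) n vertices outside them. All such small sets induce graphs of
    degeneracy o(g), so the leftover can be moved into a few reserved colours.
    In this way n vertices can be recoloured into (1 + o(1)) g colours and n / 2
    vertices into (1/2 + o(1)) g colours. With three blocks of (1/2 + o(1)) g
    colours this connects every colouring to a fixed colouring t using blocks 2
    and 3, of which block 2 covers at most n / 2 vertices: compress into blocks
    1 and 2, recolour the vertices that t puts into block 3, compress the others
    into block 1, and recolour them as in t with block 2. *)

Require Import Defs.
From mathcomp Require Import all_boot all_order all_algebra zify ring lra.
Set Implicit Arguments.
Unset Strict Implicit.
Unset Printing Implicit Defensive.
Import Order.TTheory GRing.Theory Num.Theory.

(** * Recolouring moves *)

Section Recoloring.
Variables (V C : finType) (e : rel V).
Hypotheses (e_sym : symmetric e) (e_irr : irreflexive e).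
Implicit Types (s t : {ffun V -> C}) (S T W X : {set V}) (P K : {set C}).

Definition proper_on S s : bool :=
  [forall u in S, forall v in S, e u v ==> (s u != s v)].

Lemma proper_onP S s :
  reflect {in S &, forall u v, e u v -> s u != s v} (proper_on S s).
Proof.
apply: (iffP forall_inP) => [H u v uS vS euv|H u uS].
  by have /forall_inP/(_ v vS)/implyP := H u uS; apply.
by apply/forall_inP => v vS; apply/implyP; apply: H.
Qed.

Lemma proper_onS S T s : S \subset T -> proper_on T s -> proper_on S s.
Proof.
move=> /subsetP sST /proper_onP H; apply/proper_onP => u v uS vS.
by apply: H; apply: sST.
Qed.

Definition recolor s v c : {ffun V -> C} := [ffun u => if u == v then c else s u].

Lemma recolor_same s v c : recolor s v c v = c.
Proof. by rewrite ffunE eqxx. Qed.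

Lemma recolor_other s v c u : u != v -> recolor s v c u = s u.
Proof. by rewrite ffunE => /negPf ->. Qed.

Lemma recolor_proper S s v c :
  proper_on (S :\ v) s -> {in S, forall u, e v u -> s u != c} ->
  proper_on S (recolor s v c).
Proof.
move=> /proper_onP sP vc; apply/proper_onP => x y xS yS exy; rewrite !ffunE.
have [xv|xv] := eqVneq x v; have [yv|yv] := eqVneq y v.
- by rewrite xv yv e_irr in exy.
- by rewrite eq_sym; apply: vc => //; rewrite -xv.
- by apply: vc => //; rewrite e_sym -yv.
- by apply: sP => //; rewrite !inE ?xv ?yv.
Qed.

(** Properness is demanded only on [S], so that the colouring of a part of the graph can be moved
    alone. A move may repeat the current colour. *)
Definition move_in (W : {set V}) (K : {set C}) (S : {set V}) :
    rel {ffun V -> C} :=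
  fun s t => [&& proper_on S s, proper_on S t &
    [exists v in W, exists c in K, t == recolor s v c]].

Lemma move_inP W K S s t :
  reflect [/\ proper_on S s, proper_on S t &
             exists v c, [/\ v \in W, c \in K & t = recolor s v c]]
    (move_in W K S s t).
Proof.
apply: (iffP and3P) => -[sS tS].
  by case/exists_inP => v vW /exists_inP[c cK /eqP tE]; split=> //; exists v, c.
case=> v [c [vW cK tE]]; split=> //; apply/exists_inP; exists v => //.
by apply/exists_inP; exists c => //; apply/eqP.
Qed.

Lemma move_in_sub W W' K K' S :
  W \subset W' -> K \subset K' ->
  subrel (connect (move_in W K S)) (connect (move_in W' K' S)).
Proof.
move=> /subsetP sW /subsetP sK; apply: connect_sub => s t /move_inP[sS tS].
case=> v [c [vW cK tE]]; apply: connect1; apply/move_inP; split=> //.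
by exists v, c; split => //; [apply: sW | apply: sK].
Qed.

Lemma connect_move_ind W K S (Q : {ffun V -> C} -> Prop) s t :
  (forall s t, move_in W K S s t -> Q s -> Q t) ->
  connect (move_in W K S) s t -> Q s -> Q t.
Proof.
move=> H /connectP[p pth ->]; elim: p s pth => //= t' p IH s /andP[st pth] Qs.
exact: IH pth (H _ _ st Qs).
Qed.

Lemma connect_move_fixed W K S s t :
  connect (move_in W K S) s t -> forall v, v \notin W -> t v = s v.
Proof.
move=> st v vW.
have step t1 t2 : move_in W K S t1 t2 -> t1 v = s v -> t2 v = s v.
  move=> /move_inP[_ _ [w [c [wW _ ->]]]] <-; rewrite recolor_other //.
  by apply: contraNneq vW => ->.
exact: connect_move_ind step st erefl.
Qed.

Lemma connect_move_proper W K S s t :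
  connect (move_in W K S) s t -> proper_on S s -> proper_on S t.
Proof.
move=> st sS; pose Q t := is_true (proper_on S t).
have step t1 t2 : move_in W K S t1 t2 -> Q t1 -> Q t2 by case/and3P.
exact: connect_move_ind step st sS.
Qed.

(** Required of all nonempty subsets of a set, this is [D]-degeneracy of the subgraph induced on
    it. *)
Definition sparse_vertex (D : nat) S : bool :=
  [exists v in S, #|[set u in S | e v u]| <= D].

(** At most [D + 1] colours of [K] are forbidden: [c] and those of the neighbours of [w] in [W],
    since [T] uses none of [K]. *)
Lemma spare_color (D : nat) W T K s w c :
  w \notin T -> #|[set u in W | e w u]| <= D -> D.+2 <= #|K| ->
  {in T, forall v, s v \notin K} -> proper_on ((T :|: W) :\ w) s ->
  exists c', [/\ c' \in K, c' != c & proper_on (T :|: W) (recolor s w c')].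
Proof.
move=> wT degw cK sT sP.
have /subsetPn[c' c'K] : ~~ (K \subset c |: [set s u | u in [set u in W | e w u]]).
  apply: contraL cK => /subset_leq_card cK; rewrite -ltnNge ltnS.
  apply: leq_trans cK _; apply: leq_trans (leq_card_setU _ _) _.
  by rewrite cards1 add1n ltnS; apply: leq_trans (leq_imset_card _ _) degw.
rewrite !inE negb_or => /andP[c'c c'N]; exists c'; split=> //.
apply: recolor_proper => // u; rewrite inE => /orP[uT _|uW ewu].
  by apply: contraNneq (sT _ uT) => ->.
by apply: contraNneq c'N => <-; apply: imset_f; rewrite inE uW.
Qed.

(* A path of moves of W lifts to w |: W: before each move, w is recoloured so
   that it does not use the colour about to be given to a neighbour. *)
Lemma lift_moves (D : nat) W T K w s t s' :
  w \notin T -> w \notin W -> [disjoint T & W] ->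
  #|[set u in w |: W | e w u]| <= D -> D.+2 <= #|K| ->
  {in T, forall v, s v \notin K} ->
  connect (move_in W K (T :|: W)) s t ->
  (forall v, v != w -> s' v = s v) -> proper_on (T :|: (w |: W)) s' ->
  exists t', [/\ connect (move_in (w |: W) K (T :|: (w |: W))) s' t',
                forall v, v != w -> t' v = t v &
                proper_on (T :|: (w |: W)) t'].
Proof.
move=> wT wW dTW degw cK sT /connectP[p pth ->].
elim: p s s' sT pth => /= [|s1 p IH] s s' sT.
  by move=> _ s's s'P; exists s'; split.
move=> /andP[/move_inP[_ s1P [v [c [vW cKK s1E]]]] pth] s's s'P.
have vw : v != w by apply: contraNneq wW => <-.
have vT : v \notin T by rewrite (disjointFl dTW).
have s'T : {in T, forall u, s' u \notin K}.
  move=> u uT; rewrite s's ?sT //; by apply: contraNneq wT => <-.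
have s'Pw : proper_on ((T :|: (w |: W)) :\ w) s' by apply: proper_onS s'P; apply: subD1set.
have [c' [c'K c'c s2P]] := spare_color c wT degw cK s'T s'Pw.
set s2 := recolor s' w c' in s2P.
set s3 := recolor s2 v c.
have s3E u : u != w -> s3 u = s1 u.
  by move=> uw; rewrite s1E /s3 !ffunE (negPf uw); case: eqP => // _; rewrite s's.
have s3P : proper_on (T :|: (w |: W)) s3.
  apply: recolor_proper; first by apply: proper_onS s2P; apply: subD1set.
  move=> u uS evu; have [->|uw] := eqVneq u w; first by rewrite recolor_same.
  rewrite recolor_other // s's //.
  have uv : u != v by apply: contraTneq evu => ->; rewrite e_irr.
  have := proper_onP _ _ s1P u v; rewrite s1E recolor_same recolor_other //.
  apply; rewrite ?inE ?vW ?orbT // 1?e_sym //.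
  by move: uS; rewrite !inE (negPf uw).
have s1T : {in T, forall u, s1 u \notin K}.
  by move=> u uT; rewrite s1E recolor_other ?sT //; apply: contraNneq vT => <-.
have [t' [s3t' t'E t'P]] := IH s1 s3 s1T pth s3E s3P.
exists t'; split=> //; apply: connect_trans s3t'.
apply: (@connect_trans _ _ s2); apply: connect1; apply/move_inP; split=> //.
  by exists w, c'; split; rewrite // !inE eqxx.
by exists v, c; split; rewrite // !inE vW orbT.
Qed.

(** Induction on [#|W|]: split off a vertex [w] with at most [D] neighbours in [W], lift the moves
    of the rest by [lift_moves], and finally give [w] a spare colour of [K]. *)
Lemma recolor_degenerate (D : nat) W T K s :
  (forall S, S \subset W -> S != set0 -> sparse_vertex D S) ->
  D.+2 <= #|K| -> [disjoint T & W] -> proper_on (T :|: W) s ->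
  {in T, forall v, s v \notin K} ->
  exists2 t, connect (move_in W K (T :|: W)) s t & {in W, forall v, t v \in K}.
Proof.
elim: {W}#|W| {-2}W (leqnn #|W|) s => [|k IH] W cW s degW cK dTW sP sT.
  have W0 : W = set0 by apply/eqP; rewrite -cards_eq0 -leqn0.
  by exists s => // v; rewrite W0 inE.
have [W0|Wn0] := eqVneq W set0; first by exists s => // v; rewrite W0 inE.
have /exists_inP[w wW degw] := degW W (subxx _) Wn0.
pose W' := W :\ w.
have WE : W = w |: W' by rewrite setD1K.
have wW' : w \notin W' by rewrite !inE eqxx.
have wT : w \notin T by rewrite (disjointFl dTW).
have dTW' : [disjoint T & W'] by apply: disjointWr dTW; rewrite subD1set.
have cW' : #|W'| <= k by move: cW; rewrite (cardsD1 w W) wW add1n ltnS.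
have degW' S : S \subset W' -> S != set0 -> sparse_vertex D S.
  by move=> SW; apply: degW; apply: subset_trans SW (subD1set _ _).
have [|t st tK] := IH W' cW' s degW' cK dTW' _ sT.
  by apply: proper_onS sP; rewrite setUS ?subD1set.
rewrite WE in degw sP *.
have [t' [st' t't t'P]] := lift_moves wT wW' dTW' degw cK sT st (fun _ _ => erefl) sP.
have t'T : {in T, forall u, t' u \notin K}.
  move=> u uT; rewrite (connect_move_fixed st') ?sT //.
  by rewrite -WE (disjointFr dTW).
have [|c [cKK _ tP]] := spare_color (t' w) wT degw cK t'T.
  by apply: proper_onS t'P; apply: subD1set.
exists (recolor t' w c).
  apply: connect_trans st' _; apply: connect1; apply/move_inP; split=> //.
  by exists w, c; split; rewrite // !inE eqxx.
move=> v; rewrite ffunE !inE; case: eqVneq => //= vw vW.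
by rewrite t't // tK // !inE vw.
Qed.

(** Here [s] need not be proper, so only its colour classes matter and a union bound over partitions
    applies. *)
Definition has_free_color r (a b : nat) : Prop :=
  forall s W P, #|P| = r -> {in W, forall w, s w \notin P} ->
  #|[set v | s v \in P]| <= a -> b <= #|W| ->
  exists w c, [/\ w \in W, c \in P & forall u, s u = c -> ~~ e w u].

(* Move vertices into P greedily; the set left over when no move is possible is
   small by [has_free_color], hence degenerate, and goes into K. *)
Lemma compress_palette r a b (D : nat) X P K s :
  has_free_color r a b ->
  (forall S, S != set0 -> #|S| < b -> sparse_vertex D S) ->
  #|P| = r -> D.+2 <= #|K| -> [disjoint P & K] -> #|X| <= a ->
  proper_on setT s -> (forall v, v \notin X -> s v \notin P :|: K) ->
  exists2 t, connect (move_in X setT setT) s t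
           & {in X, forall v, t v \in P :|: K}.
Proof.
move=> free sparse cP cK dPK cX sP sX.
pose reach t := connect (move_in X P setT) s t.
pose gain (t : {ffun V -> C}) := #|[set v | t v \in P]|.
have reach_s : reach s by exact: connect0.
case: (arg_maxnP gain reach_s) => t st tmax.
have tP := connect_move_proper st sP.
have tX := connect_move_fixed st.
pose W := [set v in X | t v \notin P].
have WX : W \subset X by apply/subsetP => v; rewrite inE => /andP[].
have cW : #|W| < b.
  rewrite ltnNge; apply/negP => bW.
  have tPX : #|[set v | t v \in P]| <= a.
    apply: leq_trans (subset_leq_card _) cX; apply/subsetP => v.
    rewrite inE => tvP; apply/negPn/negP => vX.
    by have := sX v vX; rewrite -tX // inE tvP.
  have [|w [c [wW cPP fr]]] := free t W P cP _ tPX bW.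
    by move=> w; rewrite inE => /andP[].
  have rP : proper_on setT (recolor t w c).
    apply: recolor_proper; first by apply: proper_onS tP; apply: subsetT.
    move=> u _ ewu; apply: contraTneq ewu; exact: fr.
  have : reach (recolor t w c).
    apply: connect_trans st _; apply: connect1; apply/move_inP; split=> //.
    by exists w, c; split=> //; apply: (subsetP WX).
  move=> /tmax; apply/negP; rewrite -ltnNge; apply: proper_card.
  apply/properP; split.
    by apply/subsetP => v; rewrite !inE ffunE; case: eqP.
  exists w; rewrite !inE ?recolor_same //; by move: wW; rewrite inE => /andP[].
pose T := ~: W.
have TW : T :|: W = setT by rewrite setUC setUCr.
have [|||||t' tt' t'K] := @recolor_degenerate D W T K t.
- move=> S SW S0; apply: sparse => //; exact: leq_ltn_trans (subset_leq_card SW) cW.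
- by [].
- by rewrite disjoints_subset.
- by rewrite TW.
- move=> v; rewrite !inE negb_and negbK => /orP[vX|tvP].
    by have := sX v vX; rewrite tX // inE negb_or => /andP[].
  by rewrite (disjointFr dPK).
exists t'.
  rewrite TW in tt'.
  apply: (@connect_trans _ _ t).
    exact: move_in_sub (subxx _) (subsetT _) _ _ st.
  exact: move_in_sub WX (subsetT _) _ _ tt'.
move=> v vX; rewrite inE; have [vW|vW] := boolP (v \in W).
  by rewrite t'K ?orbT.
rewrite (connect_move_fixed tt') //; apply/orP; left.
by move: vW; rewrite inE vX /= negbK.
Qed.

(** Every mixture of [t] on a subset of [X] with [s] elsewhere is proper, since an edge between the
    two parts compares a colour of [s] with one of [t] on [X]. So the vertices of [X] can be
    switched one at a time. *)
Lemma recolor_fresh X s t :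
  proper_on setT s -> proper_on setT t ->
  {in X, forall v u, s u != t v} ->
  connect (move_in X setT setT) s [ffun v => if v \in X then t v else s v].
Proof.
move=> sP tP fresh.
pose mix (Y : {set V}) : {ffun V -> C} := [ffun v => if v \in Y then t v else s v].
have mixP (Y : {set V}) : Y \subset X -> proper_on setT (mix Y).
  move=> /subsetP YX; apply/proper_onP => u v _ _ euv; rewrite !ffunE.
  case: ifP => uY; case: ifP => vY.
  - exact: (proper_onP _ _ tP).
  - by rewrite eq_sym fresh // YX.
  - by rewrite fresh // YX.
  - exact: (proper_onP _ _ sP).
suff H (Y : {set V}) : Y \subset X -> connect (move_in X setT setT) s (mix Y) by exact: H.
elim: {Y}#|Y| {-2}Y (erefl #|Y|) => [|k IH] Y cY YX.
  suff -> : mix Y = s by exact: connect0.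
  by apply/ffunP => v; rewrite ffunE (cards0_eq cY) inE.
have /card_gt0P[v vY] : 0 < #|Y| by rewrite cY.
have cY' : #|Y :\ v| = k by move: cY; rewrite (cardsD1 v) vY add1n => -[].
have Y'X : Y :\ v \subset X by apply: subset_trans YX; apply: subD1set.
apply: connect_trans (IH _ cY' Y'X) _; apply: connect1; apply/move_inP.
split; rewrite ?mixP //; exists v, (t v); split; rewrite ?inE //.
  exact: (subsetP YX).
by apply/ffunP => u; rewrite !ffunE !inE; case: eqVneq => [->|] //=; rewrite vY.
Qed.

End Recoloring.

(** * Three blocks of colours: connecting every colouring to one target *)

Section Connectivity.
Variables (V : finType) (e : rel V).
Hypotheses (e_sym : symmetric e) (e_irr : irreflexive e).

Definition recolorable (C : finType) : rel {ffun V -> C} :=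
  connect (@move_in V C e setT setT setT).

Variables (r l b q : nat).
Hypotheses (free1 : forall C, @has_free_color V C e r (#|V|./2) b)
           (free2 : forall C, @has_free_color V C e (r.*2 + l.+2) #|V| b)
           (sparse : forall S, S != set0 -> #|S| < b -> @sparse_vertex V e l S).
(** One block: [r] colours filled greedily and [l + 2] reserved for the leftover set. Two blocks
    have [2r + l + 2] colours besides [l + 2] reserved ones, whence the palette size in [free2]. *)
Let h := r + l.+2.
Hypothesis hq : 3 * h <= q.

(** The map [f], injective in all uses, places the [q] colours in a possibly larger colour set, so
    that colourings with extra colours can be compressed too. *)
Let inter (C : finType) (f : 'I_q -> C) (i j : nat) : {set C} :=
  f @: [set k : 'I_q | i <= k < j].

Lemma card_inter (C : finType) (f : 'I_q -> C) i j :
  injective f -> j <= q -> #|inter f i j| = j - i.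
Proof.
move=> finj jq; rewrite card_imset //.
have <- : #|[set: 'I_(j - i)]| = j - i by rewrite cardsT card_ord.
have lt_q (k : 'I_(j - i)) : i + k < q.
  by apply: leq_trans jq; rewrite -ltn_subRL.
rewrite -(card_imset _ (_ : injective (fun k => Ordinal (lt_q k)))); last first.
  by move=> k k' [] /addnI /val_inj.
apply: eq_card => k; rewrite inE; apply/idP/imsetP => [/andP[ik kj]|[k' _ ->]].
  have lt_k : k - i < j - i by rewrite ltn_sub2r //; apply: leq_ltn_trans kj.
  by exists (Ordinal lt_k); rewrite ?inE //; apply/val_inj; rewrite /= subnKC.
by rewrite /= leq_addr -ltn_subRL ltn_ord.
Qed.

Lemma mem_inter (C : finType) (f : 'I_q -> C) i j k :
  injective f -> (f k \in inter f i j) = (i <= k < j).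
Proof.
move=> finj; apply/imsetP/idP => [[k' H /finj ->]|H]; last by exists k; rewrite ?inE.
by rewrite inE in H.
Qed.

Lemma disjoint_inter (C : finType) (f : 'I_q -> C) i j i' j' :
  injective f -> j <= i' -> [disjoint inter f i j & inter f i' j'].
Proof.
move=> finj ji'; rewrite disjoints_subset; apply/subsetP => c /imsetP[k].
rewrite inE => /andP[_ kj] ->; rewrite inE mem_inter // negb_and -ltnNge.
by rewrite (leq_trans kj).
Qed.

Lemma interU (C : finType) (f : 'I_q -> C) i j k :
  i <= j -> j <= k -> inter f i j :|: inter f j k = inter f i k.
Proof.
move=> ij jk; rewrite /inter -imsetU.
apply: (congr1 (fun A : {set 'I_q} => f @: A)); apply/setP => x.
rewrite !inE; case: (ltnP x j) => xj; rewrite ?andbT ?andbF ?orbF /=.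
  by rewrite (leq_trans xj jk) andbT.
by rewrite (leq_trans ij xj).
Qed.

Lemma compress_to_two_blocks (C : finType) (f : 'I_q -> C) s :
  injective f -> proper_on e setT s ->
  exists2 t : {ffun V -> C}, recolorable s t & forall v, t v \in inter f 0 (2 * h).
Proof.
move=> finj sP; have h2 : 2 * h = r.*2 + l.+2 + l.+2.
  by rewrite /h; lia.
have q2 : 2 * h <= q by apply: leq_trans hq; rewrite leq_mul2r orbT.
have [|||||t st tP] := compress_palette (r := r.*2 + l.+2) (a := #|V|) (b := b) (D := l)
  (X := setT) (P := inter f 0 (r.*2 + l.+2)) (K := inter f (r.*2 + l.+2) (2 * h))
  e_sym e_irr (@free2 C) sparse _ _ _ _ sP; rewrite ?cardsT //.
- by rewrite card_inter ?subn0 //; apply: leq_trans q2; rewrite h2 leq_addr.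
- by rewrite card_inter // h2 addKn.
- exact: disjoint_inter.
- by move=> v; rewrite inE.
exists t => // v; move: (tP v); rewrite inE interU // ?h2 ?leq_addr //.
by apply.
Qed.

Lemma interP i j k : (k \in inter (@id 'I_q) i j) = (i <= k < j).
Proof. by rewrite (mem_inter (f := id)). Qed.

(* Obtained by compressing the rainbow colouring, whose colours are the vertices. *)
Lemma two_block_coloring_exists :
  exists2 t : {ffun V -> 'I_q}, proper_on e setT t & forall v, t v < 2 * h.
Proof.
pose s : {ffun V -> 'I_q + V} := [ffun v => inr v].
have sP : proper_on e setT s.
  apply/proper_onP => u v _ _ euv; rewrite !ffunE; apply: contraTneq euv => -[->].
  by rewrite e_irr.
have inlI : injective (@inl 'I_q V) by move=> x y [].
have [t st tP] := compress_to_two_blocks inlI sP.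
have q0 : 0 < q by apply: leq_trans hq; rewrite /h; lia.
(* The default is never taken: every value of [t] is a left injection. *)
pose t' := [ffun v => if t v is inl k then k else Ordinal q0].
have t'E v : t v = inl (t' v) /\ t' v < 2 * h.
  rewrite ffunE; have /imsetP[k] := tP v; rewrite inE => /andP[_ kh] tv.
  by rewrite tv.
exists t'; last by move=> v; case: (t'E v).
have tPr := connect_move_proper st sP.
apply/proper_onP => u v uT vT euv; have := proper_onP _ _ _ tPr u v uT vT euv.
by rewrite (t'E u).1 (t'E v).1.
Qed.

(** One of the two blocks of a two-block colouring holds at most half of the vertices; relabelling
    makes it the second block and the other one the third. *)
Lemma target_coloring_exists :
  exists t : {ffun V -> 'I_q}, [/\ proper_on e setT t,
    forall v, h <= t v < 3 * h & #|[set v | t v < 2 * h]| <= #|V|./2].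
Proof.
have [t tP t2] := two_block_coloring_exists.
have q0 : 0 < q by apply: leq_trans hq; rewrite /h; lia.
pose lo := [set v | t v < h].
have relabel (f : nat -> nat) :
    (forall x y, x < 2 * h -> y < 2 * h -> f x = f y -> x = y) ->
    (forall k, k < 2 * h -> h <= f k < 3 * h) ->
    #|[set v | f (t v) < 2 * h]| <= #|V|./2 ->
    exists t : {ffun V -> 'I_q}, [/\ proper_on e setT t,
      forall v, h <= t v < 3 * h & #|[set v | t v < 2 * h]| <= #|V|./2].
  move=> finj fh cf; pose t' := [ffun v => insubd (Ordinal q0) (f (t v))].
  have t'E v : t' v = f (t v) :> nat.
    rewrite ffunE insubdK //; have /andP[_ H] := fh _ (t2 v).
    exact: leq_trans H hq.
  exists t'; split.
  - apply/proper_onP => u v uT vT euv; have := proper_onP _ _ _ tP u v uT vT euv.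
    apply: contraNneq => /(congr1 val); rewrite /= !t'E => E.
    by apply/eqP/val_inj; apply: finj E; apply: t2.
  - by move=> v; rewrite t'E fh.
  - by move: cf; congr (_ <= _); apply: eq_card => v; rewrite !inE t'E.
have cV : #|lo| + #|~: lo| = #|V| by rewrite cardsC.
have [clo|clo] := leqP #|lo| #|V|./2.
  apply: (relabel (addn^~ h)).
  - by move=> x y _ _ /addIn.
  - by move=> k; lia.
  - apply: leq_trans clo; apply: subset_leq_card; apply/subsetP => v.
    by rewrite !inE; lia.
apply: (relabel (fun k => if k < h then k + 2 * h else k)).
- by move=> x y; case: (ltnP x h) => ?; case: (ltnP y h) => ?; lia.
- by move=> k; case: (ltnP k h); lia.
- apply: (@leq_trans #|~: lo|); last by lia.
  apply: subset_leq_card; apply/subsetP => v; rewrite !inE.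
  by case: (ltnP (t v) h); lia.
Qed.

(* The path: compress s into the first two blocks of h colours, recolour the
   part of t lying in the third block, compress the rest Y (at most half of the
   vertices) into the first block, and recolour Y as in t with the second. *)
Lemma recolorable_to_target : exists2 t : {ffun V -> 'I_q}, proper_on e setT t &
  forall s : {ffun V -> 'I_q}, proper_on e setT s -> recolorable s t.
Proof.
have [t [tP th cY]] := target_coloring_exists; exists t => // s sP.
set Y := [set v | t v < 2 * h] in cY.
have idI : injective (@id 'I_q) by [].
have [s1 ss1 s1h] := compress_to_two_blocks idI sP.
have s1P := connect_move_proper ss1 sP.
have {}s1h v : s1 v < 2 * h by have := s1h v; rewrite interP.
have s12 : {in ~: Y, forall v u, s1 u != t v}.
  move=> v; rewrite !inE -leqNgt => tv u; apply: contraTneq tv => <-.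
  by rewrite -ltnNge.
have {}s12 := recolor_fresh s1P tP s12; set s2 := finfun _ in s12.
have s2P := connect_move_proper s12 s1P.
have s2Y v : v \notin Y -> s2 v = t v by move=> vY; rewrite ffunE inE vY.
have s2Y' v : v \notin Y -> s2 v \notin inter (@id 'I_q) 0 r :|: inter (@id 'I_q) r h.
  move=> vY; rewrite s2Y // inE !interP; move: vY; rewrite inE.
  by rewrite /h; lia.
have [|||s3 s23 s3h] := compress_palette (P := inter (@id 'I_q) 0 r)
  (K := inter (@id 'I_q) r h) e_sym e_irr (@free1 _) sparse _ _ _ cY s2P s2Y'.
- by rewrite card_inter // ?subn0 //; apply: leq_trans hq; rewrite /h; lia.
- by have hq' := hq; rewrite card_inter // /h in hq' *; lia.
- exact: disjoint_inter.
have s3P := connect_move_proper s23 s2P.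
have s3Y v : v \notin Y -> s3 v = t v by move=> vY; rewrite (connect_move_fixed s23) ?s2Y.
have {}s3h v : v \in Y -> s3 v < h.
  by move=> vY; have := s3h v vY; rewrite interU ?leq_addr // interP.
have s34 : {in Y, forall v u, s3 u != t v}.
  move=> v; rewrite inE => tv u; have [uY|uY] := boolP (u \in Y).
    apply/eqP => E; have := s3h u uY; rewrite E ltnNge.
    by have /andP[-> _] := th v.
  by apply/eqP => E; move: (uY); rewrite inE -(s3Y u uY) E tv.
have {}s34 := recolor_fresh s3P tP s34.
have tE : [ffun v => if v \in Y then t v else s3 v] = t.
  by apply/ffunP => v; rewrite ffunE; case: ifPn => // /s3Y.
rewrite tE in s34.
apply: connect_trans ss1 _.
apply: connect_trans (move_in_sub (subsetT _) (subxx _) s12) _.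
apply: connect_trans (move_in_sub (subsetT _) (subxx _) s23) _.
exact: (move_in_sub (subsetT _) (subxx _) s34).
Qed.

End Connectivity.

(** * Comparison of G(n,m) with G(n,p) *)

Local Open Scope ring_scope.

Section Bernoulli.
Variables (R : comPzRingType) (T : finType) (p : T -> R).
Implicit Types (E B : {set T}).

(** The law of a random subset containing each [x] independently with probability [p x]. The
    identities below are polynomial and hold over any commutative ring. *)
Definition bernoulli_weight E : R := \prod_x (if x \in E then p x else 1 - p x).
Local Notation mu := bernoulli_weight.

Lemma sum_bernoulli_weight (y : T -> R) :
  \sum_(E : {set T}) mu E * (\prod_(x in E) y x) =
  \prod_x (p x * y x + (1 - p x)).
Proof.
rewrite (bigA_distr _ _ (fun x => p x * y x) (fun x => 1 - p x)) /=.
apply: eq_big => // E _; rewrite [X in _ * X]big_mkcond -big_split /=.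
by apply: eq_bigr => x _; case: ifP => // _; rewrite mulr1.
Qed.

Lemma sum_bernoulli_avoid B :
  \sum_(E : {set T}) mu E * [disjoint E & B]%:R = \prod_(x in B) (1 - p x).
Proof.
rewrite [RHS]big_mkcond /=.
transitivity (\sum_(E : {set T}) mu E * (\prod_(x in E) (x \notin B)%:R : R)).
  apply: eq_bigr => E _; congr (_ * _).
  have [dEB|] := boolP [disjoint E & B].
    by rewrite big1 // => x xE; rewrite (disjointFr dEB).
  rewrite disjoints_subset => /subsetPn[x xE]; rewrite inE negbK => xB.
  by rewrite (bigD1 x) //= xB mul0r.
rewrite sum_bernoulli_weight; apply: eq_bigr => x _.
by case: ifP => xB /=; rewrite ?mulr0 ?add0r // mulr1 addrC subrK.
Qed.

(** Independence by inclusion-exclusion: expand the product of [1 - [disjoint E & B j]] over subsets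
    [A] of [D]. Avoiding all [B j] with [j] in [A] means avoiding their union, whose weight factors
    by disjointness. *)
Lemma sum_bernoulli_hit (J : finType) (D : {set J}) (B : J -> {set T}) :
  {in D &, forall i j, i != j -> [disjoint B i & B j]} ->
  \sum_(E : {set T} | [forall j in D, ~~ [disjoint E & B j]]) mu E =
  \prod_(j in D) (1 - \prod_(x in B j) (1 - p x)).
Proof.
move=> disj; rewrite big_mkcond /=.
pose k j : R := (j \in D)%:R.
have expand (F : J -> R) : \prod_(j in D) (1 - F j) =
    \sum_(A : {set J} | A \subset D) (\prod_(j in A) -1) * \prod_(j in A) F j.
  transitivity (\prod_j (- (k j * F j) + 1)).
    rewrite big_mkcond; apply: eq_bigr => j _; rewrite /k.
    by case: ifP => _; rewrite ?mul1r ?mul0r ?oppr0 ?add0r // addrC.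
  rewrite (bigA_distr _ _ (fun j => - (k j * F j)) (fun j => 1)) /= [RHS]big_mkcond /=.
  apply: eq_bigr => A _; rewrite -big_mkcond /=; case: ifP => [/subsetP sAD|/negbT].
    rewrite -big_split /=; apply: eq_bigr => j jA.
    by rewrite /k sAD // mul1r mulN1r.
  by case/subsetPn => j jA jD; rewrite (bigD1 j) //= /k (negPf jD) mul0r oppr0 mul0r.
rewrite expand.
transitivity (\sum_(E : {set T}) \sum_(A : {set J} | A \subset D)
    (\prod_(j in A) -1) * (mu E * [disjoint E & \bigcup_(j in A) B j]%:R)).
  apply: eq_bigr => E _.
  transitivity (mu E * \prod_(j in D) (1 - [disjoint E & B j]%:R)).
    case: ifPn => [/forall_inP H|].
      rewrite big1 ?mulr1 // => j jD; by rewrite (negPf (H j jD)) subr0.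
    rewrite negb_forall_in => /exists_inP[j jD]; rewrite negbK => H.
    by rewrite (bigD1 j) //= H subrr mul0r mulr0.
  rewrite expand big_distrr /=; apply: eq_bigr => A AD; rewrite mulrCA; congr (_ * (_ * _)).
  have [dE|] := boolP [disjoint E & _].
    rewrite big1 // => j jA; suff -> : [disjoint E & B j] by [].
    by apply: disjointWr dE; apply: bigcup_sup.
  rewrite disjoints_subset => /subsetPn[x xE]; rewrite inE negbK => /bigcupP[j jA xB].
  rewrite (bigD1 j) //= -[RHS](mul0r (\prod_(i in A | i != j) [disjoint E & B i]%:R)).
  congr (_ * _); case: (boolP [disjoint _ & _]) => // /disjointFr /(_ xE).
  by rewrite xB.
rewrite exchange_big /=; apply: eq_bigr => A AD; rewrite -big_distrr /=; congr (_ * _).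
pose B' j := if j \in A then B j else set0.
have -> : \bigcup_(j in A) B j = \bigcup_j B' j by rewrite big_mkcond.
rewrite sum_bernoulli_avoid partition_disjoint_bigcup => [|i j ij].
  rewrite [RHS]big_mkcond; apply: eq_bigr => j _; rewrite /B'.
  by case: ifP => // _; rewrite big_set0.
rewrite /B'; case: ifP => iA; last by rewrite disjoints_subset sub0set.
case: ifP => jA; last by rewrite disjoint_sym disjoints_subset sub0set.
by apply: disj => //; apply: (subsetP AD).
Qed.

End Bernoulli.

(** The ratio of consecutive terms is [(N - j) m / ((j + 1) (N - m))], at least 1 for [j < m] and at
    most 1 for [j >= m]; [tS] states it with denominators cleared. *)
Lemma binomial_mode (N m k : nat) : (m <= N)%N -> (k <= N)%N ->
  ('C(N, k) * (m ^ k * (N - m) ^ (N - k)) <=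
   'C(N, m) * (m ^ m * (N - m) ^ (N - m)))%N.
Proof.
move=> mN; pose t k := ('C(N, k) * (m ^ k * (N - m) ^ (N - k)))%N.
rewrite -/(t k) -/(t m).
have tS j : (j < N)%N -> (j.+1 * t j.+1 * (N - m) = (N - j) * m * t j)%N.
  move=> jN; rewrite /t mulnA mul_bin_left expnS subnS.
  have [i ->] : exists i, (N - j = i.+1)%N by exists (N - j).-1; lia.
  by rewrite /= expnS; ring.
have up j : (j < m)%N -> (t j <= t j.+1)%N.
  move=> jm; have jN : (j < N)%N by apply: leq_trans mN.
  (* For [m = N] the ratio has a zero denominator, but then [t j = 0] for [j < m]. *)
  have [E|Nm] := eqVneq (N - m)%N 0%N.
    by rewrite /t E [in X in (X <= _)%N]exp0n ?subn_gt0 // !muln0.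
  rewrite -(@leq_pmul2l (j.+1 * (N - m))); last by rewrite muln_gt0 /= lt0n.
  rewrite -[X in (_ <= X)%N]mulnA [X in (_ <= _ * X)%N]mulnC mulnA tS //.
  rewrite leq_mul2r; apply/orP; right; nia.
have down j : (m <= j < N)%N -> (t j.+1 <= t j)%N.
  case/andP => mj jN.
  rewrite -(@leq_pmul2l (j.+1 * (N - m))); last by rewrite muln_gt0 subn_gt0 (leq_ltn_trans mj jN).
  rewrite -[X in (X <= _)%N]mulnA [X in (_ * X <= _)%N]mulnC mulnA tS //.
  rewrite leq_mul2r; apply/orP; right; nia.
have [km|mk] := leqP k m.
  move=> _; rewrite -(subKn km); elim: (m - k)%N => [|i IH]; first by rewrite subn0.
  have [im|mi] := ltnP i m; last first.
    by have -> : (m - i.+1 = m - i)%N by lia.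
  by apply: leq_trans IH; have := up (m - i.+1)%N; rewrite subnSK //; apply; lia.
rewrite -(subnKC (ltnW mk)); elim: (k - m)%N => [|i IH]; first by rewrite addn0.
by move=> iN; apply: leq_trans (IH _); rewrite ?addnS ?down //; lia.
Qed.

(** Expand [(m + (N - m))^N]: each of the [N + 1] terms is at most the one at the mode. *)
Lemma binomial_mode_ge (N m : nat) : (m <= N)%N ->
  (N ^ N <= N.+1 * ('C(N, m) * (m ^ m * (N - m) ^ (N - m))))%N.
Proof.
move=> mN; rewrite -{1}(subnK mN) expnDn -[X in (_ <= X * _)%N]card_ord -sum_nat_const.
apply: leq_sum => -[i /=]; rewrite ltnS => iN _.
by rewrite [X in (_ * X <= _)%N]mulnC binomial_mode.
Qed.

(** * From a fixed number of edges to independent edges *)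

Definition edge_pairs (n : nat) : {set {set 'I_n}} := [set e : {set 'I_n} | #|e| == 2%N].

Lemma card_edge_pairs n : #|edge_pairs n| = 'C(n, 2).
Proof. by rewrite card_draws card_ord. Qed.

Lemma graphsE n m :
  graphs n m = [set E : {set {set 'I_n}} | E \subset edge_pairs n & #|E| == m].
Proof.
apply/setP => E; rewrite !inE; congr (_ && _); apply/forall_inP/subsetP => H e eE.
  by rewrite inE H.
by have := H e eE; rewrite inE.
Qed.

Lemma card_graphs n m : #|graphs n m| = 'C('C(n, 2), m).
Proof. by rewrite graphsE cards_draws card_edge_pairs. Qed.

(* G(n,p) with p = m / 'C(n, 2); sets having an element that is not a pair get
   weight 0. *)
Definition gnp_weight (R : numFieldType) (n m : nat) : {set {set 'I_n}} -> R :=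
  bernoulli_weight (fun e => if e \in edge_pairs n then m%:R / 'C(n, 2)%:R else 0).
Arguments gnp_weight R n m E : clear implicits.

Section Transfer.
Variables (R : numFieldType) (n m : nat).
Hypotheses (N_gt0 : (0 < 'C(n, 2))%N) (m_le : (m <= 'C(n, 2))%N).
Let N := 'C(n, 2).
Let p : R := m%:R / N%:R.

Lemma edge_density01 : 0 <= p <= 1.
Proof.
by rewrite divr_ge0 ?ler0n //= ler_pdivrMr ?ltr0n // mul1r ler_nat.
Qed.

Lemma gnp_weight_ge0 E : 0 <= gnp_weight R n m E.
Proof.
have /andP[p0 p1] := edge_density01.
apply: prodr_ge0 => e _; case: ifP => _; case: ifP => _; rewrite ?subr_ge0 //.
Qed.

Lemma gnp_weight_graph E : E \in graphs n m ->
  gnp_weight R n m E = p ^+ m * (1 - p) ^+ (N - m).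
Proof.
rewrite graphsE inE => /andP[sE /eqP cE].
rewrite /gnp_weight /bernoulli_weight (bigID (mem (edge_pairs n))) /=.
rewrite [X in _ * X]big1 ?mulr1 => [|e /negPf eP]; last first.
  rewrite eP subr0; case: ifP => // eE.
  by move: (fintype.subsetP sE e eE); rewrite eP.
rewrite (bigID (mem E)) /=; congr (_ * _).
  rewrite -[X in _ ^+ X]cE -prodr_const; apply: eq_big => [e|e /andP[-> ->]] //.
  by rewrite andb_idl // => /(fintype.subsetP sE).
have -> : (N - m)%N = #|edge_pairs n :\: E| by rewrite cardsDS // card_edge_pairs cE.
rewrite -prodr_const.
by apply: eq_big => [e|e /andP[-> /negPf ->]] //; rewrite !inE andbC.
Qed.

(* The binomial law with mean m has its mode at m, so a graph of G(n,p) has m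
   edges with probability at least 1 / (N + 1). *)
Lemma gnm_le_gnp (Q : pred {set {set 'I_n}}) :
  #|[set E in graphs n m | Q E]|%:R / #|graphs n m|%:R <=
  N.+1%:R * \sum_(E | Q E) gnp_weight R n m E :> R.
Proof.
pose w : R := p ^+ m * (1 - p) ^+ (N - m).
have N0 : N%:R != 0 :> R by rewrite pnatr_eq0 -lt0n.
have wge : 1 <= N.+1%:R * (#|graphs n m|%:R * w).
  have := binomial_mode_ge m_le; rewrite -(ler_nat R).
  rewrite -/N !natrM !natrX natrB // card_graphs -/N => H.
  have wE : w = m%:R ^+ m * (N%:R - m%:R) ^+ (N - m) / N%:R ^+ N.
    have NE : N = (m + (N - m))%N by rewrite subnKC.
    rewrite /w /p [X in _ / _ ^+ X]NE exprD !expr_div_n.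
    have -> : 1 - m%:R / N%:R = (N%:R - m%:R) / N%:R :> R.
      by rewrite mulrBl divff.
    by rewrite expr_div_n invfM mulrACA.
  by rewrite wE !mulrA ler_pdivlMr ?exprn_gt0 ?ltr0n // mul1r -!mulrA.
have C0 : 0 < #|graphs n m|%:R :> R by rewrite ltr0n card_graphs bin_gt0.
rewrite ler_pdivrMr //.
have le1 : #|[set E in graphs n m | Q E]|%:R * w <= \sum_(E | Q E) gnp_weight R n m E.
  rewrite mulr_natl -sumr_const [leLHS]big_mkcond [leRHS]big_mkcond.
  apply: ler_sum => E _; rewrite inE; case: ifP => [/andP[EG ->]|_].
    by rewrite gnp_weight_graph.
  by case: ifP => // _; apply: gnp_weight_ge0.
apply: (@le_trans _ _ (#|[set E in graphs n m | Q E]|%:R * (N.+1%:R * (#|graphs n m|%:R * w)))).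
  by rewrite -[leLHS]mulr1 ler_wpM2l.
have -> a : a * (N.+1%:R * (#|graphs n m|%:R * w)) = N.+1%:R * (a * w) * #|graphs n m|%:R :> R.
  by ring.
by rewrite ler_wpM2r ?ler0n // ler_wpM2l ?ler0n.
Qed.

End Transfer.

(** * The two bad events *)

Lemma set2_inj (T : finType) (w u u' : T) : w != u -> [set w; u] = [set w; u'] -> u = u'.
Proof.
move=> wu E; have : u \in [set w; u'] by rewrite -E set22.
by rewrite !inE [_ == w]eq_sym (negPf wu) => /eqP.
Qed.

(* [f v] is [Some (Some i)] for v in the i-th class, [None] for v in the set W
   of vertices to be blocked by all classes, and [Some None] elsewhere. *)
Section BlockedVertices.
Variables (n r : nat) (f : {ffun 'I_n -> option (option 'I_r)}).

Definition part_class (i : 'I_r) : {set 'I_n} := [set v | f v == Some (Some i)].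

Definition blocked (E : {set {set 'I_n}}) : bool :=
  [forall w, forall i : 'I_r, (f w == None) ==>
     [exists u in part_class i, [set w; u] \in E]].

(** For different [(w, i)] with [f w = None], the sets of pairs joining [w] to class [i] are
    disjoint, because the classes contain no such [w]. Hence [sum_bernoulli_hit] applies. *)
Lemma gnp_blocked (R : numFieldType) (m : nat) :
  \sum_(E | blocked E) gnp_weight R n m E =
  \prod_(w | f w == None) \prod_(i < r)
    (1 - (1 - m%:R / 'C(n, 2)%:R) ^+ #|part_class i|).
Proof.
pose D := [set j : 'I_n * 'I_r | f j.1 == None].
pose B (j : 'I_n * 'I_r) := [set [set j.1; u] | u in part_class j.2].
have nWA w i u : f w == None -> u \in part_class i -> w != u.
  by rewrite inE => /eqP fw; apply: contraTneq => <-; rewrite fw.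
transitivity (\sum_(E : {set {set 'I_n}} | [forall j in D, ~~ [disjoint E & B j]])
    gnp_weight R n m E).
  apply: eq_bigl => E; apply/forallP/forall_inP => [H [w i]|H w].
    rewrite inE /= => fw; have /forallP/(_ i)/implyP/(_ fw)/exists_inP[u ui wuE] := H w.
    apply/negP => /disjointFr/(_ wuE)/negP; apply.
    by apply/imsetP; exists u.
  apply/forallP => i; apply/implyP => fw.
  have := H (w, i); rewrite inE => /(_ fw).
  rewrite disjoints_subset => /subsetPn[e eE]; rewrite inE negbK => /imsetP[u ui eu].
  by apply/exists_inP; exists u => //; rewrite -eu.
rewrite sum_bernoulli_hit; last first.
  move=> [w i] [w' i']; rewrite !inE /= => fw fw' ne.
  rewrite disjoints_subset; apply/subsetP => e /imsetP[u ui /= ->]; rewrite inE.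
  apply/negP => /imsetP[u' /= u'i' E]; move/eqP: ne; apply.
  have ww' : w = w'.
    have : w \in [set w'; u'] by rewrite -E set21.
    by rewrite !inE (negPf (nWA _ _ _ fw u'i')) orbF => /eqP.
  rewrite -ww' in E; move: u'i'; rewrite -(set2_inj (nWA _ _ _ fw ui) E).
  by move: ui; rewrite !inE /= ww' => /eqP-> /eqP[->].
rewrite pair_big /=; apply: eq_big => [[w i]|[w i]]; rewrite inE /= ?andbT // => fw.
congr (1 - _); rewrite big_imset /=; last first.
  by move=> u u' ui _; apply: set2_inj (nWA _ _ _ fw ui).
rewrite -prodr_const; apply: eq_bigr => u ui.
by rewrite inE cards2 (nWA _ _ _ fw ui).
Qed.

End BlockedVertices.

Section DenseSets.
Variables (n l : nat).
Implicit Types (S : {set 'I_n}) (E : {set {set 'I_n}}).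

Definition adj E : rel 'I_n := fun u v => [set u; v] \in E.

Definition inner_pairs S : {set {set 'I_n}} := [set e : {set 'I_n} | e \subset S & #|e| == 2%N].

Lemma dense_edges S E : E \subset edge_pairs n -> ~~ sparse_vertex (adj E) l S ->
  (l.+1 * #|S| <= 2 * #|E :&: inner_pairs S|)%N.
Proof.
move=> /subsetP sE; rewrite negb_exists_in => /forall_inP dS.
have E2 e : e \in E -> #|e| = 2%N by move=> /sE; rewrite inE => /eqP.
have deg v : v \in S -> (l.+1 <= #|[set e in E :&: inner_pairs S | v \in e]|)%N.
  move=> vS; have := dS v vS; rewrite -ltnNge => /leq_trans; apply.
  have vu u : adj E v u -> v != u by move=> /E2; rewrite cards2; case: (v == u).
  rewrite -(card_in_imset (f := fun u => [set v; u])); last first.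
    by move=> u u'; rewrite !inE => /andP[_ /vu wu] _; apply: set2_inj.
  apply: subset_leq_card; apply/subsetP => e /imsetP[u]; rewrite inE => /andP[uS evu] ->.
  rewrite /adj in evu; rewrite !inE eqxx evu (E2 _ evu) eqxx !andbT /=.
  by apply/subsetP => x; rewrite !inE => /orP[]/eqP->.
rewrite mulnC -sum_nat_const.
apply: (@leq_trans (\sum_(v in S) #|[set e in E :&: inner_pairs S | v \in e]|)).
  exact: leq_sum.
rewrite (eq_bigr (fun v => \sum_(e in E :&: inner_pairs S) (v \in e))%N); last first.
  move=> v _; rewrite -sum1_card big_mkcond [RHS]big_mkcond; apply: eq_bigr => e _.
  by rewrite [LHS]/= in_set; case: (e \in E :&: _); case: (v \in e).
rewrite exchange_big /= mulnC -sum_nat_const; apply: leq_sum => e eE.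
have <- : #|e| = 2%N by apply: E2; move: eE; rewrite inE => /andP[].
rewrite -sum1_card big_mkcond [X in (_ <= X)%N]big_mkcond; apply: leq_sum => v _.
by case: ifP => _; case: (v \in e).
Qed.

(** Markov's inequality for [z ^ (2 #|E :&: inner_pairs S|)], whose expectation is computed by
    [sum_bernoulli_weight]. *)
Lemma gnp_dense (R : numFieldType) (m : nat) S (z : R) :
  (0 < 'C(n, 2))%N -> (m <= 'C(n, 2))%N -> 1 <= z ->
  (\sum_(E | ~~ sparse_vertex (adj E) l S) gnp_weight R n m E) * z ^+ (l.+1 * #|S|) <=
  (m%:R / 'C(n, 2)%:R * z ^+ 2 + (1 - m%:R / 'C(n, 2)%:R)) ^+ 'C(#|S|, 2).
Proof.
move=> N0 mN z1.
have -> : 'C(#|S|, 2) = #|inner_pairs S| by rewrite cards_draws.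
rewrite -prodr_const.
pose y (e : {set 'I_n}) := if e \in inner_pairs S then z ^+ 2 else 1.
have z0 : 0 <= z by apply: le_trans z1.
apply: (@le_trans _ _ (\sum_(E : {set {set 'I_n}}) gnp_weight R n m E * \prod_(x in E) y x)).
  rewrite big_distrl /= [leLHS]big_mkcond /=; apply: ler_sum => E _.
  have mu0 := gnp_weight_ge0 R N0 mN E.
  have yE : \prod_(x in E) y x = z ^+ (2 * #|E :&: inner_pairs S|).
    rewrite exprM -prodr_const [RHS]big_mkcond [LHS]big_mkcond; apply: eq_bigr => x _.
    by rewrite inE /y; case: (x \in E); case: (x \in inner_pairs S).
  case: ifPn => [dS|_]; last by rewrite yE mulr_ge0 ?exprn_ge0.
  have [sE|/subsetPn[e eE eP]] := boolP (E \subset edge_pairs n).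
    by rewrite yE ler_wpM2l // ler_weXn2l // dense_edges.
  suff -> : gnp_weight R n m E = 0 by rewrite !mul0r.
  by rewrite /gnp_weight /bernoulli_weight (bigD1 e) //= eE (negPf eP) mul0r.
rewrite sum_bernoulli_weight le_eqVlt; apply/orP; left; apply/eqP.
rewrite [RHS]big_mkcond; apply: eq_bigr => e _; rewrite /y.
case: (boolP (e \in inner_pairs S)) => eS; last by rewrite mulr1 addrC subrK.
by have -> : e \in edge_pairs n by move: eS; rewrite !inE => /andP[].
Qed.

End DenseSets.

(** * Union bounds, and connectivity outside the bad events *)

Definition bad_partition (n r a b : nat) (E : {set {set 'I_n}}) : bool :=
  [exists f : {ffun 'I_n -> option (option 'I_r)},
    [&& \sum_i #|part_class f i| <= a, b <= #|[set w | f w == None]| & blocked f E]%N].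

Definition bad_subset (n l b : nat) (E : {set {set 'I_n}}) : bool :=
  [exists S : {set 'I_n},
    [&& S != set0, (#|S| < b)%N & ~~ sparse_vertex (adj E) l S]].

(** Class [i] consists of the vertices outside [W] with the [i]-th colour of [P]. Colours outside
    [P] are not told apart, so [(r + 2)^n] configurations cover all maps [s], whatever the number of
    colours. *)
Lemma has_free_colorP (n r a b : nat) (E : {set {set 'I_n}}) (C : finType) :
  ~~ bad_partition r a b E -> has_free_color C (adj E) r a b.
Proof.
move=> good s W P cP sW ca cb.
pose f : {ffun 'I_n -> option (option 'I_r)} :=
  (* For a colour outside [P] the index is [r], so [insub] yields [None]. *)
  [ffun v => if v \in W then None else Some (insub (index (s v) (enum P)))].
have szP : size (enum P) = r by rewrite -cardE.
have fN v : (f v == None) = (v \in W) by rewrite ffunE; case: (v \in W).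
move: good; rewrite negb_exists => /forallP/(_ f); rewrite negb_and.
have -> /= : (\sum_i #|part_class f i| <= a)%N.
  apply: leq_trans ca; rewrite -sum1_card [X in (_ <= X)%N]big_mkcond /=.
  under eq_bigr do rewrite -sum1_card big_mkcond /=.
  rewrite exchange_big; apply: leq_sum => v _; rewrite inE.
  have [i0 fv|fv] := pickP (fun i => f v == Some (Some i)).
    have sP : s v \in P.
      move: fv; rewrite ffunE; case: ifP => // _; case: insubP => // k lt_r _ _.
      by rewrite -mem_enum -index_mem szP.
    rewrite sP (bigD1 i0) //= inE fv big1 // => i ii0.
    by rewrite inE (eqP fv) /eq_op /= /eq_op /= eq_sym (negPf ii0).
  by rewrite big1 // => i _; rewrite inE fv.
rewrite negb_and; have -> /= : (b <= #|[set w | f w == None]|)%N.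
  by apply: leq_trans cb _; apply: subset_leq_card; apply/subsetP => w wW; rewrite inE fN.
rewrite negb_forall => /existsP[w]; rewrite negb_forall => /existsP[i].
rewrite negb_imply => /andP[fw]; rewrite negb_exists_in => /forall_inP nadj.
rewrite fN in fw.
case: (pickP (mem P)) => [c0 c0P|P0]; last first.
  by have := ltn_ord i; rewrite -{2}cP (eq_card0 P0).
have ir : (i < size (enum P))%N by rewrite szP.
have cPn : nth c0 (enum P) i \in P by rewrite -mem_enum mem_nth.
exists w, (nth c0 (enum P) i); split=> // u su.
apply: nadj; rewrite inE ffunE; case: ifPn => [uW|_].
  by have := sW u uW; rewrite su cPn.
rewrite su index_uniq ?enum_uniq //; case: insubP => [k _ ki|]; last by rewrite ltn_ord.
by apply/eqP; do 2![congr Some]; apply: val_inj.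
Qed.

Lemma bad_partition_le (R : numFieldType) (n m r a b : nat) :
  (0 < 'C(n, 2))%N -> (m <= 'C(n, 2))%N ->
  \sum_(E | bad_partition r a b E) gnp_weight R n m E <=
  \sum_(f : {ffun 'I_n -> option (option 'I_r)} |
         (\sum_i #|part_class f i| <= a)%N && (b <= #|[set w | f w == None]|)%N)
    \prod_(w | f w == None) \prod_(i < r)
      (1 - (1 - m%:R / 'C(n, 2)%:R) ^+ #|part_class f i|).
Proof.
move=> N0 mN; under [leRHS]eq_bigr do rewrite -gnp_blocked.
rewrite (exchange_big_dep predT) //= [leLHS]big_mkcond /=; apply: ler_sum => E _.
have mu0 := gnp_weight_ge0 R N0 mN.
case: ifP => [/existsP[f /and3P[fa fb fE]]|_]; last by apply: sumr_ge0.
rewrite (bigD1 f) /=; last by rewrite fa fb fE.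
by rewrite lerDl; apply: sumr_ge0.
Qed.

Lemma bad_subset_le (R : numFieldType) (n m l b : nat) :
  (0 < 'C(n, 2))%N -> (m <= 'C(n, 2))%N ->
  \sum_(E | bad_subset l b E) gnp_weight R n m E <=
  \sum_(S : {set 'I_n} | (S != set0) && (#|S| < b)%N)
    \sum_(E | ~~ sparse_vertex (adj E) l S) gnp_weight R n m E.
Proof.
move=> N0 mN.
rewrite (exchange_big_dep predT) //= [leLHS]big_mkcond /=; apply: ler_sum => E _.
have mu0 := gnp_weight_ge0 R N0 mN.
case: ifP => [/existsP[S /and3P[Sa Sb SE]]|_]; last by apply: sumr_ge0.
rewrite (bigD1 S) /=; last by rewrite Sa Sb SE.
by rewrite lerDl; apply: sumr_ge0.
Qed.

Lemma recoloring_connected (n m r l b q : nat) (E : {set {set 'I_n}}) :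
  E \in graphs n m -> ~~ bad_partition r n./2 b E ->
  ~~ bad_partition (r.*2 + l.+2) n b E -> ~~ bad_subset l b E ->
  (3 * (r + l.+2) <= q)%N ->
  exists2 t, t \in proper_colorings q E &
    forall s, s \in proper_colorings q E -> connect (@recolor_adj n q E) s t.
Proof.
move=> EG good1 good2 good3 hq.
have e_sym : symmetric (adj E) by move=> u v; rewrite /adj setUC.
have e_irr : irreflexive (adj E).
  move=> v; apply/negP => vE; move: EG; rewrite graphsE inE => /andP[/subsetP/(_ _ vE)].
  by rewrite inE cards2 eqxx.
have properE (s : {ffun 'I_n -> 'I_q}) : proper_on (adj E) setT s = (s \in proper_colorings q E).
  rewrite inE; apply/proper_onP/forallP => [H u|H u v _ _ euv].
    by apply/forallP => v; apply/implyP; apply: H.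
  by have /forallP/(_ v)/implyP := H u; apply.
have sparse S : S != set0 -> (#|S| < b)%N -> sparse_vertex (adj E) l S.
  move=> S0 Sb; move: good3; rewrite negb_exists => /forallP/(_ S).
  by rewrite S0 Sb negbK.
have [||t tP conn] := @recolorable_to_target _ _ e_sym e_irr r l b q _ _ sparse hq.
- by move=> C; apply: has_free_colorP; rewrite card_ord.
- by move=> C; apply: has_free_colorP; rewrite card_ord.
exists t; first by rewrite -properE.
move=> s; rewrite -properE => /conn; apply: connect_sub => {}s {}t {tP conn} /move_inP[sP tP].
(* Moves that keep the colour are dropped, as adjacency needs distance exactly 1. *)
case=> v [c [_ _ tE]]; have [scv|scv] := eqVneq (s v) c.
  suff -> : t = s by exact: connect0.
  by apply/ffunP => u; rewrite tE ffunE; case: (eqVneq u v) => [->|//].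
apply: connect1; rewrite /recolor_adj -!properE sP tP /hamming.
apply/eqP; rewrite (_ : [set u | _] = [set v]) ?cards1 //.
apply/setP => u; rewrite !inE tE ffunE; case: (eqVneq u v) => [->|_].
  by rewrite scv.
by rewrite eqxx.
Qed.

(** * Estimates *)

From mathcomp Require Import all_classical all_reals all_analysis.
Import numFieldNormedType.Exports.
Local Open Scope ring_scope.

(** All colourings are joined to one [t], so its component contains everything and the error is 0;
    the existence of [t] ensures that there is a component at all. *)
Lemma connected_giant_component (R : realType) (n m r l b q : nat) (E : {set {set 'I_n}}) :
  E \in graphs n m -> ~~ bad_partition r n./2 b E ->
  ~~ bad_partition (r.*2 + l.+2) n b E -> ~~ bad_subset l b E ->
  (3 * (r + l.+2) <= q)%N -> giant_component q (0 : R) E.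
Proof.
move=> EG good1 good2 good3 hq.
have [t tP conn] := recoloring_connected EG good1 good2 good3 hq.
have symE : symmetric (connect (@recolor_adj n q E)).
  apply: sym_connect_sym => s s'; rewrite /recolor_adj andbCA; congr [&& _, _ & _ == _].
  by apply: eq_card => v; rewrite !inE eq_sym.
apply/exists_inP; exists (proper_colorings q E); last by rewrite subr0 mul1r.
apply/imsetP; exists t => //; apply/setP => s; rewrite [RHS]finset.in_set.
by case: (boolP (s \in proper_colorings q E)) => //= sP; rewrite symE conn.
Qed.

Section Estimates.
Variable R : realType.

(** For [y = p / (1 - p)] one has [1 + y = 1 / (1 - p)]; invert [1 + y <= expR y]. *)
Lemma expR_le_onem (p : R) : p < 1 -> expR (- (p / (1 - p))) <= 1 - p.
Proof.
move=> p1; have q0 : 0 < 1 - p by rewrite subr_gt0.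
rewrite expRN -[leRHS]invrK lef_pV2 ?posrE ?expR_gt0 ?invr_gt0 //.
apply: le_trans (expR_ge1Dx _); rewrite le_eqVlt; apply/orP; left; apply/eqP.
by field; rewrite lt0r_neq0.
Qed.

(* Convexity of [exp], in the form of its tangent line at the mean. *)
Lemma sum_expRN_ge (r : nat) (a : nat) (x : 'I_r -> nat) (tau : R) :
  (0 < r)%N -> 0 <= tau -> (\sum_i x i <= a)%N ->
  r%:R * expR (- (tau * a%:R / r%:R)) <= \sum_i expR (- (tau * (x i)%:R)).
Proof.
move=> r0 tau0 xa; set y := tau * a%:R / r%:R.
have rR : 0 < r%:R :> R by rewrite ltr0n.
apply: (@le_trans _ _ (\sum_i expR (- y) * (1 + (y - tau * (x i)%:R)))).
  rewrite -big_distrr /= mulrC ler_wpM2l ?expR_ge0 // !big_split /= sumrN.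
  rewrite !sumr_const card_ord -big_distrr /= -natr_sum -mulr_natr.
  have yr : y *+ r = tau * a%:R by rewrite -mulr_natr /y divfK ?lt0r_neq0.
  rewrite yr mul1r lerDl subr_ge0 ler_wpM2l // ler_nat //.
apply: ler_sum => i _.
have E : - (tau * (x i)%:R) = - y + (y - tau * (x i)%:R) by ring.
by rewrite [in leRHS]E expRD ler_wpM2l ?expR_ge0 // expR_ge1Dx.
Qed.

(** By [1 - x <= expR (- x)], the lower bound on [1 - p] and convexity, each of at least [b]
    vertices is blocked by all classes with probability at most [expR (- Y)]. The factor [r.+2 ^ n]
    counts the configurations. *)
Lemma bad_partition_bound (n m r a b : nat) (tau : R) :
  (0 < 'C(n, 2))%N -> (m <= 'C(n, 2))%N -> (0 < r)%N -> 0 <= tau ->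
  expR (- tau) <= 1 - m%:R / 'C(n, 2)%:R ->
  \sum_(E | bad_partition r a b E) gnp_weight R n m E <=
  r.+2%:R ^+ n * expR (- (b%:R * (r%:R * expR (- (tau * a%:R / r%:R))))).
Proof.
move=> N0 mN r0 tau0 ptau; apply: le_trans (bad_partition_le _ _ _ _ N0 mN) _.
set z := 1 - _ in ptau *; set Y := r%:R * _.
have /andP[p0 p1] := edge_density01 R N0 mN.
have z0 : 0 <= z by rewrite subr_ge0.
have z1 : z <= 1 by rewrite lerBlDr lerDl.
have Y0 : 0 <= Y by rewrite mulr_ge0 // expR_ge0.
have cf : #|{ffun 'I_n -> option (option 'I_r)}| = (r.+2 ^ n)%N.
  by rewrite card_ffun !card_option !card_ord.
rewrite -natrX -cf mulr_natl -[leRHS]sumr_const [leLHS]big_mkcond /=.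
apply: ler_sum => f _; case: ifP => [/andP[fa fb]|_]; last exact: expR_ge0.
have inner : 0 <= \prod_(i < r) (1 - z ^+ #|part_class f i|) <= expR (- Y).
  apply/andP; split.
    by apply: prodr_ge0 => i _; rewrite subr_ge0 exprn_ile1.
  apply: (@le_trans _ _ (\prod_(i < r) expR (- expR (- (tau * #|part_class f i|%:R))))).
    apply: ler_prod => i _; rewrite subr_ge0 exprn_ile1 //=.
    apply: le_trans (expR_ge1Dx _); rewrite lerD2l lerN2.
    by rewrite -mulNr expRM_natr lerXn2r // nnegrE expR_ge0.
  rewrite -expR_sum ler_expR sumrN lerN2; exact: sum_expRN_ge.
apply: (@le_trans _ _ (\prod_(w | f w == None) expR (- Y))).
  by apply: ler_prod => w _.
rewrite prodr_const -expRM_natl ler_expR mulrN lerN2 ler_wpM2r // ler_nat.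
by move: fb; rewrite cardsE.
Qed.

End Estimates.

Section DenseEstimate.
Variable R : realType.

(** With [u = expR (- lam)], so that [n u = s], one has ['C(n, s) u^s <= (1 + u)^n <= expR s]. This
    is the bound [(e n / s)^s]. *)
Lemma bin_le_expR (n s : nat) (lam : R) : n%:R = s%:R * expR lam ->
  'C(n, s)%:R <= expR (s%:R * (1 + lam)).
Proof.
move=> nE; pose u := expR (- lam).
have u0 : 0 < u := expR_gt0 _.
have : 'C(n, s)%:R * u ^+ s <= expR (s%:R).
  apply: (@le_trans _ _ ((1 + u) ^+ n)).
    rewrite exprDn; have [sn|ns] := leqP s n; last first.
      rewrite bin_small // mul0r; apply: sumr_ge0 => i _.
      by rewrite mulrn_wge0 // mulr_ge0 // exprn_ge0 // ltW.
    rewrite (bigD1 (Ordinal (sn : (s < n.+1)%N))) //= expr1n mul1r mulr_natl lerDl.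
    by apply: sumr_ge0 => i _; rewrite mulrn_wge0 // mulr_ge0 // exprn_ge0 // ltW.
  have -> : s%:R = n%:R * u by rewrite nE -mulrA -expRD addrN expR0 mulr1.
  by rewrite expRM_natl lerXn2r ?nnegrE ?expR_ge0 ?addr_ge0 ?(ltW u0) // expR_ge1Dx.
rewrite -ler_pdivlMr ?exprn_gt0 // /u -expRM_natl -expRN -expRD.
by move/le_trans; apply; rewrite ler_expR le_eqVlt; apply/orP; left; apply/eqP; ring.
Qed.

(* Chernoff bound [gnp_dense] with z = (n / s)^(1/4), where lam = ln (n / s). *)
Lemma gnp_dense_bound (n m l s : nat) (d lam Lam : R) (S : {set 'I_n}) :
  (0 < 'C(n, 2))%N -> (m <= 'C(n, 2))%N ->
  m%:R / 'C(n, 2)%:R <= 2 * d / n%:R ->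
  (0 < s)%N -> #|S| = s -> n%:R = s%:R * expR lam -> 0 <= d -> 0 <= Lam <= lam ->
  \sum_(E | ~~ sparse_vertex (adj E) l S) gnp_weight R n m E <=
  expR (s%:R * (d * expR (- (Lam / 2)) - lam * l.+1%:R / 4)).
Proof.
move=> N0 mN pd s0 cS nE d0 /andP[Lam0 Laml].
have s0R : 0 < s%:R :> R by rewrite ltr0n.
have n0 : 0 < n%:R :> R by rewrite nE mulr_gt0 // expR_gt0.
have /andP[p0 p1] := edge_density01 R N0 mN.
set p := m%:R / _ in pd p0 p1 *.
pose z := expR (lam / 4).
have z1 : 1 <= z by rewrite -expR0 ler_expR divr_ge0 // (le_trans Lam0).
have := gnp_dense l S N0 mN z1; rewrite -/p cS -ler_pdivlMr; last first.
  by rewrite exprn_gt0 // (lt_le_trans ltr01).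
move/le_trans; apply; rewrite ler_pdivrMr; last first.
  by rewrite exprn_gt0 // (lt_le_trans ltr01).
rewrite /z -!expRM_natl -expRD.
apply: (@le_trans _ _ (expR (p * expR (2 * (lam / 4))) ^+ 'C(s, 2))).
  apply: lerXn2r; rewrite ?nnegrE ?expR_ge0 //.
    by rewrite addr_ge0 ?subr_ge0 ?mulr_ge0 ?expR_ge0.
  by apply: le_trans (expR_ge1Dx _); rewrite addrC lerD2r; lra.
rewrite -expRM_natl ler_expR.
have C2 : 'C(s, 2)%:R * 2 <= s%:R ^+ 2 :> R.
  rewrite -natrM -natrX ler_nat mulnC mul_bin_left bin1 expnS expn1 leq_mul2r leq_subr.
  by rewrite orbT.
have half : expR (- (lam / 2)) <= expR (- (Lam / 2)) by rewrite ler_expR; lra.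
(* Uses ['C(s, 2) <= s^2 / 2] and [p s expR lam = p n <= 2 d]. *)
have key : 'C(s, 2)%:R * (p * expR (2 * (lam / 4))) <= s%:R * (d * expR (- (Lam / 2))).
  apply: (@le_trans _ _ (s%:R * (d * expR (- (lam / 2))))); last first.
    by rewrite ler_wpM2l ?(ltW s0R) // ler_wpM2l.
  have -> : expR (2 * (lam / 4)) = expR (- (lam / 2)) * expR lam.
    by rewrite -expRD; congr expR; lra.
  have pn : p * expR lam * s%:R <= 2 * d.
    by move: pd; rewrite ler_pdivlMr // nE => H; rewrite -mulrA [expR lam * _]mulrC.
  rewrite [leLHS](_ : _ = expR (- (lam / 2)) * ('C(s, 2)%:R * (p * expR lam))); last by ring.
  rewrite [leRHS](_ : _ = expR (- (lam / 2)) * (s%:R * d)); last by ring.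
  rewrite ler_wpM2l ?expR_ge0 //.
  rewrite -(@ler_pM2r _ 2) //.
  apply: (@le_trans _ _ (s%:R ^+ 2 * (p * expR lam))).
    by rewrite mulrAC ler_wpM2r // mulr_ge0 // expR_ge0.
  rewrite expr2 -mulrA [leRHS](_ : _ = s%:R * (2 * d)); last by ring.
  by rewrite ler_wpM2l ?(ltW s0R) // mulrC.
apply: le_trans key _; rewrite natrM le_eqVlt; apply/orP; left; apply/eqP.
by field.
Qed.

(** For each size [s], the number of sets times the Chernoff bound is at most
    [expR (- 4 (s + lam)) <= n^-4], and there are [n + 1] sizes. The fourth power pays for the
    factor, at most [n^2], lost in [gnm_le_gnp]. *)
Lemma bad_subset_bound (n m l b : nat) (d Lam : R) :
  (0 < 'C(n, 2))%N -> (m <= 'C(n, 2))%N ->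
  m%:R / 'C(n, 2)%:R <= 2 * d / n%:R -> 0 <= d -> 0 <= Lam ->
  (forall s, (s < b)%N -> s%:R <= n%:R * expR (- Lam)) ->
  5 + d * expR (- (Lam / 2)) <= (l.+1%:R / 4 - 5) * Lam ->
  \sum_(E | bad_subset l b E) gnp_weight R n m E <= n.+1%:R / n%:R ^+ 4.
Proof.
move=> N0 mN pd d0 Lam0 sb key.
have n0 : 0 < n%:R :> R by rewrite ltr0n; case: (n) N0.
apply: le_trans (bad_subset_le _ _ _ N0 mN) _.
rewrite (partition_big (fun S : {set 'I_n} => inord #|S| : 'I_n.+1) predT) //=.
rewrite [leRHS]mulr_natl -[X in _ *+ X]card_ord -[leRHS]sumr_const.
apply: ler_sum => -[s sn] _.
have cS (S : {set 'I_n}) : inord #|S| = Ordinal sn -> #|S| = s.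
  move=> /(congr1 val); rewrite /= inordK // ltnS.
  by rewrite -[X in (_ <= X)%N]card_ord max_card.
have [s0|/andP[s0 lt_sb]] : ~~ ((0 < s) && (s < b))%N \/ ((0 < s) && (s < b))%N.
- by case: (_ && _); [right|left].
- rewrite big1 ?invr_ge0 ?exprn_ge0 ?(ltW n0) // => S /andP[/andP[S0 Sb] /eqP/cS sE].
  by move: s0; rewrite -sE Sb card_gt0 S0.
have s0R : 0 < s%:R :> R by rewrite ltr0n.
pose lam := ln (n%:R / s%:R : R).
have nE : n%:R = s%:R * expR lam.
  by rewrite lnK ?posrE ?divr_gt0 // mulrC divfK // lt0r_neq0.
have Laml : 0 <= Lam <= lam.
  rewrite Lam0 -ler_expR lnK ?posrE ?divr_gt0 // ler_pdivlMr // mulrC.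
  by have := sb s lt_sb; rewrite expRN ler_pdivlMr ?expR_gt0.
pose B := expR (s%:R * (d * expR (- (Lam / 2)) - lam * l.+1%:R / 4)).
apply: (@le_trans _ _ (\sum_(S : {set 'I_n} | #|S| == s) B)).
  rewrite [leLHS]big_mkcond [leRHS]big_mkcond; apply: ler_sum => S _.
  case: ifP => [/andP[_ /eqP/cS sE]|_]; last by case: ifP => _; rewrite ?expR_ge0.
  by rewrite sE eqxx; apply: gnp_dense_bound.
rewrite sumr_const (_ : #|_| = 'C(n, s)); last first.
  rewrite -[n in RHS]card_ord -card_draws; apply: eq_card => S.
  by rewrite !inE.
rewrite -[leLHS]mulr_natl.
apply: (@le_trans _ _ (expR (s%:R * (1 + lam)) * B)).
  by rewrite ler_wpM2r ?expR_ge0 // bin_le_expR.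
have s1 : 1 <= s%:R :> R by rewrite (ler_nat _ 1).
rewrite /B -expRD -mulrDr; have /andP[_ Ll] := Laml.
set k := l.+1%:R in key *; set D := d * _ in key *.
have lam0 : 0 <= lam by apply: le_trans Ll.
have D0 : 0 <= D by rewrite mulr_ge0 // expR_ge0.
(* Forced by [key], whose left side is positive; it allows replacing [Lam] in [key] by the larger
   [lam]. *)
have k5 : 0 <= k / 4 - 5.
  rewrite leNgt; apply/negP => k5.
  have : (k / 4 - 5) * Lam <= 0 by rewrite mulr_le0_ge0 // ltW.
  lra.
have key2 : 5 + D <= (k / 4 - 5) * lam by apply: le_trans key _; rewrite ler_wpM2l.
(* The two 5s in [key] give [1 + lam + D - lam k / 4 <= - 4 (1 + lam)]. *)
have expo : s%:R * (1 + lam + (D - lam * k / 4)) <= 4%:R * (- (s%:R + lam)).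
  have : s%:R * (1 + lam + (D - lam * k / 4)) <= s%:R * (- 4 * (1 + lam)).
    by rewrite ler_wpM2l //; lra.
  have : lam <= s%:R * lam by rewrite ler_peMl.
  by lra.
apply: (@le_trans _ _ (expR (4%:R * (- (s%:R + lam))))); first by rewrite ler_expR.
rewrite expRM_natl -exprVn lerXn2r ?nnegrE ?expR_ge0 ?invr_ge0 ?(ltW n0) //.
rewrite expRN lef_pV2 ?posrE ?expR_gt0 // nE expRD ler_wpM2r ?expR_ge0 //.
by apply: le_trans (expR_ge1Dx _); rewrite lerDr.
Qed.

End DenseEstimate.

(** * Probabilities of the bad events in G(n,m) *)

Section Conclusion.
Variable R : realType.

(** The cubic term of the exponential series suffices: for large [L],
    [(a L)^3 / 6 >= 4 C L^2 >= C (L + 1)^2]. *)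
Lemma expR_dominates_square (a C : R) : 0 < a -> 0 < C ->
  exists2 L0 : R, 4 <= L0 & forall L, L0 <= L -> C * (L + 1) ^+ 2 <= expR (a * L).
Proof.
move=> a0 C0; have a3 : 0 < a ^+ 3 by rewrite exprn_gt0.
have C24 : 0 <= 24 * C / a ^+ 3 by apply: divr_ge0; [lra | exact: ltW].
exists (4 + 24 * C / a ^+ 3) => [|L hL]; first by rewrite lerDl.
have L4 : 4 <= L by lra.
have aL : 0 <= a * L by rewrite mulr_ge0 ?(ltW a0) //; lra.
have := expR_ge1Dxn 2 aL; rewrite (_ : 3`!%:R = 6 :> R) //.
have : 24 * C <= a ^+ 3 * L by rewrite [leRHS]mulrC -ler_pdivrMr //; lra.
move=> H1 H2; apply: (@le_trans _ _ ((a * L) ^+ 3 / 6)); last by lra.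
rewrite exprMn [_ / 6](_ : _ = (a ^+ 3 * L) * (L ^+ 2 / 6)); last by field.
apply: (@le_trans _ _ (24 * C * (L ^+ 2 / 6))); last first.
  by rewrite ler_wpM2r // divr_ge0 // sqr_ge0.
rewrite [leRHS](_ : _ = C * (4 * L ^+ 2)); last by field.
by rewrite ler_wpM2l ?(ltW C0) //; nra.
Qed.

Lemma prob_Gnm_union (n m : nat) (A B1 B2 B3 : pred {set {set 'I_n}}) :
  (m <= 'C(n, 2))%N ->
  (forall E, E \in graphs n m -> ~~ B1 E -> ~~ B2 E -> ~~ B3 E -> A E) ->
  1 - (prob_Gnm R n m B1 + prob_Gnm R n m B2 + prob_Gnm R n m B3) <= prob_Gnm R n m A.
Proof.
move=> mN H; have C0 : 0 < #|graphs n m|%:R :> R by rewrite ltr0n card_graphs bin_gt0.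
rewrite lerBlDr /prob_Gnm -!mulrDl ler_pdivlMr // mul1r -!natrD ler_nat.
apply: (@leq_trans #|[set E in graphs n m | A E] :|: [set E in graphs n m | B1 E] :|:
  [set E in graphs n m | B2 E] :|: [set E in graphs n m | B3 E]|).
  apply: subset_leq_card; apply/fintype.subsetP => E EG; rewrite !inE.
  rewrite inE in EG; rewrite EG /=.
  have := H E; rewrite inE EG => /(_ isT).
  by case: (A E); case: (B1 E); case: (B2 E); case: (B3 E) => //= /(_ isT isT isT).
do 2!(apply: leq_trans (leq_card_setU _ _) _; rewrite ?addnA leq_add2r).
exact: leq_card_setU.
Qed.

Lemma edge_density (d : R) (n : nat) : 0 <= d -> d + 2 <= n%:R ->
  let m := Num.truncn (d * n%:R / 2) in
  [/\ (0 < 'C(n, 2))%N, (m <= 'C(n, 2))%N &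
      m%:R / 'C(n, 2)%:R <= d / (n%:R - 1) :> R].
Proof.
move=> d0 dn m.
have n2 : (1 < n)%N by rewrite -(ltr_nat R); lra.
have NE : 'C(n, 2)%:R = n%:R * (n%:R - 1) / 2 :> R.
  have := mul_bin_left n 1; rewrite bin1 => /(congr1 (fun k => k%:R : R)).
  by rewrite !natrM natrB 1?ltnW // => H; lra.
have N0 : (0 < 'C(n, 2))%N by rewrite bin_gt0.
have NR : 0 < 'C(n, 2)%:R :> R by rewrite ltr0n.
have mle : m%:R <= d * n%:R / 2 by rewrite truncn_le divr_ge0 ?mulr_ge0.
have n1 : 0 < n%:R - 1 :> R by lra.
have n0 : 0 < n%:R :> R by lra.
split=> //.
  rewrite -(ler_nat R); apply: le_trans mle _; rewrite NE ler_wpM2r //.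
  by rewrite mulrC ler_wpM2l ?(ltW n0) //; lra.
rewrite ler_pdivrMr //; apply: le_trans mle _; rewrite NE.
by rewrite le_eqVlt; apply/orP; left; apply/eqP; field; rewrite lt0r_neq0.
Qed.

Lemma bin2_le_sqr (n : nat) : (0 < n)%N -> (('C(n, 2)).+1 <= n ^ 2)%N.
Proof.
by move=> n0; have := mul_bin_left n 1; rewrite bin1 expnS expn1; nia.
Qed.

(** The last hypothesis brings the exponent down to [- n], and [n^2 expR (- n) <= 6 / n] because
    [n^3 / 6 <= expR n]. *)
Lemma bad_partition_small (n m r a b : nat) (tau : R) :
  (0 < 'C(n, 2))%N -> (m <= 'C(n, 2))%N -> (0 < r)%N -> 0 <= tau ->
  expR (- tau) <= 1 - m%:R / 'C(n, 2)%:R ->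
  n%:R * (ln (r.+2%:R) + 1) <= b%:R * (r%:R * expR (- (tau * a%:R / r%:R))) ->
  prob_Gnm R n m (bad_partition r a b) <= 6 / n%:R.
Proof.
move=> N0 mN r0 tau0 ptau H.
have n0 : (0 < n)%N by case: (n) N0.
have nR : 0 < n%:R :> R by rewrite ltr0n.
apply: le_trans (gnm_le_gnp R N0 mN _) _.
have bound : \sum_(E | bad_partition r a b E) gnp_weight R n m E <= expR (- n%:R).
  apply: le_trans (bad_partition_bound _ _ N0 mN r0 tau0 ptau) _.
  have -> : r.+2%:R ^+ n = expR (n%:R * ln r.+2%:R) :> R.
    by rewrite expRM_natl lnK // posrE ltr0n.
  by rewrite -expRD ler_expR; lra.
apply: (@le_trans _ _ (n%:R ^+ 2 * expR (- n%:R))).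
  apply: ler_pM => //; first by apply: sumr_ge0 => E _; apply: gnp_weight_ge0.
  by rewrite -natrX ler_nat bin2_le_sqr.
rewrite expRN ler_pdivlMr // mulrAC -exprSr ler_pdivrMr ?expR_gt0 //.
have := expR_ge1Dxn 2 (ltW nR); rewrite (_ : 3`!%:R = 6 :> R) // => K; lra.
Qed.

Lemma bad_subset_small (n m l b : nat) (d Lam : R) :
  (0 < 'C(n, 2))%N -> (m <= 'C(n, 2))%N ->
  m%:R / 'C(n, 2)%:R <= 2 * d / n%:R -> 0 <= d -> 0 <= Lam ->
  (forall s, (s < b)%N -> s%:R <= n%:R * expR (- Lam)) ->
  5 + d * expR (- (Lam / 2)) <= (l.+1%:R / 4 - 5) * Lam ->
  prob_Gnm R n m (bad_subset l b) <= 2 / n%:R.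
Proof.
move=> N0 mN pd d0 Lam0 sb key.
have n0 : (0 < n)%N by case: (n) N0.
have nR : 0 < n%:R :> R by rewrite ltr0n.
have n1 : 1 <= n%:R :> R by rewrite (ler_nat _ 1).
apply: le_trans (gnm_le_gnp R N0 mN _) _.
have bound := bad_subset_bound N0 mN pd d0 Lam0 sb key.
apply: (@le_trans _ _ (n%:R ^+ 2 * (n.+1%:R / n%:R ^+ 4))).
  apply: ler_pM => //; first by apply: sumr_ge0 => E _; apply: gnp_weight_ge0.
  by rewrite -natrX ler_nat bin2_le_sqr.
rewrite [leLHS](_ : _ = n.+1%:R / n%:R / n%:R); last by field; rewrite lt0r_neq0.
by rewrite ler_wpM2r ?invr_ge0 ?(ltW nR) // ler_pdivrMr // -natr1; lra.
Qed.

End Conclusion.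

(** * Choice of palette sizes for large average degree *)

Section LargeDegree.
Variables (R : realType) (eps L : R).
Hypotheses (eps_gt0 : 0 < eps) (eps_le : eps <= 1 / 10) (L_ge4 : 4 <= L).
Hypothesis L_large : 100 / eps ^+ 2 * (L + 1) ^+ 2 <= expR (eps / 16 * L).
Let d := expR L.
Let g := d / L.
(** As [L = ln d], this is [d^(eps/16)]; [L_large] makes it beat the polynomial factors in [L] and
    [1 / eps]. *)
Let x := expR (eps / 16 * L).

Let d_gt0 : 0 < d := expR_gt0 _.
Let x_gt0 : 0 < x := expR_gt0 _.

Let L_gt0 : 0 < L.
Proof. exact: lt_le_trans L_ge4. Qed.

Let g_gt0 : 0 < g.
Proof. by rewrite divr_gt0 // L_gt0. Qed.

Let gL : g * L = d.
Proof. by rewrite /g divfK // lt0r_neq0 // L_gt0. Qed.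

Let x_eps2_ge : 100 * (L + 1) ^+ 2 <= x * eps ^+ 2.
Proof. by rewrite -ler_pdivrMr ?exprn_gt0 // mulrAC. Qed.

Let eps2_le1 : eps ^+ 2 <= 1.
Proof. by have := eps_gt0; have := eps_le; nra. Qed.

Let x_ge : 100 * (L + 1) ^+ 2 <= x.
Proof.
by apply: le_trans x_eps2_ge _; rewrite ler_piMr ?eps2_le1 // ltW.
Qed.

Let d_eps2_ge : 100 * (L + 1) ^+ 2 <= d * eps ^+ 2.
Proof.
apply: le_trans x_eps2_ge _; rewrite ler_wpM2r ?sqr_ge0 // ler_expR.
by rewrite ler_piMl ?(ltW L_gt0) //; have := eps_le; lra.
Qed.

(** The value 44 is what makes [(eps g - 2) / 4 - 5 >= eps g / 8] in [palette_sizes_exist]. *)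
Let eps_g_ge : 44 <= eps * g.
Proof.
suff : 44 * L <= eps * d by rewrite -ler_pdivlMr ?L_gt0 // mulrA.
have H := d_eps2_ge; have L0 := L_gt0; have d0 := d_gt0.
have : d * eps ^+ 2 <= eps * d.
  rewrite expr2 mulrA mulrC mulrA ler_piMr ?mulr_ge0 ?(ltW eps_gt0) ?(ltW d0) //.
  by have := eps_le; lra.
by nra.
Qed.

(** Take [l + 2] and [r - 1] as the integer parts of [eps g] and [(1 + eps) g / 2]. Then
    [3 (r + l + 2) <= (3/2 + 9 eps / 2) g + 3], and the remaining [eps g / 2] absorbs the 3. *)
Lemma palette_sizes_exist (q : nat) : (3 / 2 + 5 * eps) * g <= q%:R ->
  exists r l : nat, [/\ (0 < r)%N, (3 * (r + l.+2) <= q)%N, (1 + eps) * g / 2 < r%:R,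
    (r.*2 + l.+4)%:R <= d & eps * g / 8 <= l.+1%:R / 4 - 5].
Proof.
move=> hq; have eg := eps_g_ge; have g0 := g_gt0.
have e1 := eps_le.
have [l /andP[l2 l3]] : exists l : nat, l.+2%:R <= eps * g < l.+3%:R.
  have eg0 : 0 <= eps * g by apply: le_trans eg.
  have H := truncn_itv eg0.
  have : (2 <= Num.truncn (eps * g))%N by rewrite truncn_ge_nat //; lra.
  by move: H; case: (Num.truncn _) => [|[|l]] // H _; exists l.
have rg0 : 0 <= (1 + eps) * g / 2.
  by rewrite divr_ge0 // mulr_ge0 ?(ltW g0) // addr_ge0 // ltW.
have /andP[rb ra] := truncn_itv rg0.
set k := Num.truncn _ in rb ra.
have kE : k.+1%:R = k%:R + 1 :> R by rewrite natr1.
exists k.+1, l; split=> //.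
- rewrite -(ler_nat R) natrM natrD kE; apply: le_trans hq; lra.
- have l4E : l.+4%:R = l.+2%:R + 2 :> R by rewrite -natrD addn2.
  rewrite natrD -mul2n natrM kE l4E.
  have : g * 4 <= d by rewrite -gL ler_wpM2l // ltW.
  have : eps * g <= 1 / 10 * g by rewrite ler_wpM2r // ltW.
  have := d_eps2_ge; have := L_ge4; have := eps2_le1; have := d_gt0.
  move=> d0 e2 L4 H.
  have d4 : 100 <= d.
    apply: le_trans (_ : d * eps ^+ 2 <= d); last by rewrite ler_piMr // ltW.
    apply: le_trans H; nra.
  by lra.
- by have l3E : l.+3%:R = l.+1%:R + 2 :> R by [rewrite -natrD addn2]; lra.
Qed.

(** The exponential equals [1 / x], so the left side is at most [5 + d eps^2 / 100], while the right
    side is at least [d eps^2 / 64]. *)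
Lemma subset_exponent (l : nat) : eps * g / 8 <= l.+1%:R / 4 - 5 ->
  5 + d * expR (- (eps / 8 * L / 2)) <= (l.+1%:R / 4 - 5) * (eps / 8 * L).
Proof.
move=> lg; have L0 := L_gt0.
have -> : expR (- (eps / 8 * L / 2)) = x^-1 by rewrite -expRN; congr expR; lra.
have xV : d / x <= d * eps ^+ 2 / 100.
  rewrite ler_pdivrMr // -[leLHS]mulr1 -!mulrA ler_wpM2l ?(ltW d_gt0) //.
  have := x_eps2_ge; have : 1 <= (L + 1) ^+ 2 by move: L0; nra.
  by move=> H1 H2; lra.
have Lam0 : 0 <= eps / 8 * L by rewrite mulr_ge0 ?(ltW L0) // divr_ge0 // ltW.
apply: le_trans (_ : eps * g / 8 * (eps / 8 * L) <= _); last by rewrite ler_wpM2r.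
have -> : eps * g / 8 * (eps / 8 * L) = eps ^+ 2 * (g * L) / 64 by field.
have := d_eps2_ge; have : 25 <= (L + 1) ^+ 2 by move: L_ge4; nra.
by rewrite gL => H1 H2; lra.
Qed.

(** Covers both palettes: [r1 = r] with [a = n./2], and [r1 = 2r + l + 2] with [a = n]. The mean
    class size [a / r1] is below [n / ((1 + eps) g)], so the exponent is at most [(1 - eps / 4) L].
    The right side is then at least [n d^(eps/8) / (2 L) = n x^2 / (2 L)]. *)
Lemma partition_exponent (n r r1 a b : nat) (tau : R) :
  (0 < n)%N -> (r <= r1)%N -> (1 + eps) * g / 2 < r%:R -> r1.+2%:R <= d ->
  2 * r%:R * a%:R <= r1%:R * n%:R :> R -> tau = (1 + eps / 2) * d / n%:R ->
  n%:R * expR (- (eps / 8 * L)) < b%:R ->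
  n%:R * (ln r1.+2%:R + 1) <= b%:R * (r1%:R * expR (- (tau * a%:R / r1%:R))).
Proof.
move=> n0 rr1 ra r1d ar tauE bb; have L0 := L_gt0; have g0 := g_gt0.
have nR : 0 < n%:R :> R by rewrite ltr0n.
have g2r : g / 2 <= r%:R.
  apply: le_trans (ltW ra); rewrite ler_wpM2r // ler_peMl ?(ltW g0) //.
  by rewrite lerDl ltW.
have rR : 0 < r%:R :> R by apply: lt_le_trans g2r; rewrite divr_gt0.
have r1R : 0 < r1%:R :> R by apply: lt_le_trans rR _; rewrite ler_nat.
have lnr : ln (r1.+2%:R : R) <= L by rewrite -(expRK L) ler_ln ?posrE ?ltr0n ?expR_gt0.
have ya : tau * a%:R / r1%:R <= (1 - eps / 4) * L.
  rewrite ler_pdivrMr // tauE mulrAC ler_pdivrMr //.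
  have e4 : 0 <= 1 - eps / 4 by move: eps_le; lra.
  have H : (1 + eps / 2) * d <= (1 - eps / 4) * L * (2 * r%:R).
    rewrite -gL [leLHS](_ : _ = (1 + eps / 2) * g * L); last by ring.
    rewrite [leRHS](_ : _ = (1 - eps / 4) * (2 * r%:R) * L); last by ring.
    rewrite ler_wpM2r ?(ltW L0) //.
    apply: le_trans (_ : (1 - eps / 4) * ((1 + eps) * g) <= _); last first.
      by rewrite ler_wpM2l //; move: ra; lra.
    rewrite [leRHS]mulrA ler_wpM2r ?(ltW g0) //.
    by have e0 := eps_gt0; have e1 := eps_le; nra.
  apply: (@le_trans _ _ ((1 - eps / 4) * L * (2 * r%:R) * a%:R)); first by rewrite ler_wpM2r.
  rewrite -[leLHS]mulrA -[leRHS]mulrA ler_wpM2l //.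
  by rewrite mulr_ge0 // ltW.
have expy : expR (- ((1 - eps / 4) * L)) <= expR (- (tau * a%:R / r1%:R)).
  by rewrite ler_expR lerN2.
apply: (@le_trans _ _ (n%:R * (L + 1))); first by rewrite ler_wpM2l ?(ltW nR) // lerD2r.
apply: (@le_trans _ _ (n%:R * expR (- (eps / 8 * L)) *
    (g / 2 * expR (- ((1 - eps / 4) * L))))); last first.
  have g20 : 0 <= g / 2 by rewrite divr_ge0 // ltW.
  have ger1 : g / 2 <= r1%:R by apply: le_trans g2r _; rewrite ler_nat.
  apply: ler_pM (ltW bb) (ler_pM g20 (expR_ge0 _) ger1 expy).
    by rewrite mulr_ge0 ?expR_ge0.
  by rewrite mulr_ge0 ?expR_ge0.
rewrite -mulrA ler_wpM2l ?(ltW nR) //.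
have -> : expR (- (eps / 8 * L)) * (g / 2 * expR (- ((1 - eps / 4) * L))) = x ^+ 2 / (2 * L).
  have -> : expR (- ((1 - eps / 4) * L)) = x ^+ 2 * expR (eps / 8 * L) / d.
    by rewrite /d /x -expRN -expRM_natl -!expRD; congr expR; field.
  rewrite /g expRN; field.
  by rewrite !lt0r_neq0 // expR_gt0.
rewrite ler_pdivlMr; last by rewrite mulr_gt0.
have xg := x_ge; rewrite expr2.
apply: (@le_trans _ _ (100 * (L + 1) ^+ 2 * 1)); first by nra.
by apply: ler_pM => //; nra.
Qed.

End LargeDegree.

(** At [p = d / (n - 1)] the exponent in [expR_le_onem] is [d / (n - 1 - d)]; for large [n] the
    factor [1 + eps / 2] absorbs the [1 + d] in the denominator. *)
Lemma density_bounds (R : realType) (d eps p : R) (n : nat) :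
  0 < d -> 0 < eps -> d + 2 <= n%:R ->
  (1 + eps / 2) * (1 + d) / (eps / 2) <= n%:R -> p <= d / (n%:R - 1) ->
  expR (- ((1 + eps / 2) * d / n%:R)) <= 1 - p /\ p <= 2 * d / n%:R.
Proof.
move=> d0 e0 nd ne pd.
have nR : 0 < n%:R :> R by lra.
have n1 : 0 < n%:R - 1 :> R by lra.
have n1d : 0 < n%:R - 1 - d :> R by lra.
split.
  have p1 : d / (n%:R - 1) < 1 by rewrite ltr_pdivrMr //; lra.
  apply: (@le_trans _ _ (1 - d / (n%:R - 1))); last by rewrite lerB.
  apply: le_trans (expR_le_onem p1); rewrite ler_expR lerN2.
  have -> : d / (n%:R - 1) / (1 - d / (n%:R - 1)) = d / (n%:R - 1 - d).
    by field; rewrite !lt0r_neq0.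
  rewrite [leRHS]mulrAC [leRHS]mulrC ler_wpM2l ?(ltW d0) //.
  rewrite -[leLHS]mul1r ler_pdivrMr // mulrAC ler_pdivlMr // mul1r.
  move: ne; rewrite ler_pdivrMr; last by lra.
  by move=> ne; lra.
apply: le_trans pd _; rewrite [leRHS](_ : _ = d * (2 / n%:R)); last by ring.
rewrite ler_wpM2l ?(ltW d0) //.
rewrite -[leLHS]mul1r ler_pdivrMr // mulrAC ler_pdivlMr //; lra.
Qed.

(** * The limit as [n] grows *)

Local Open Scope classical_set_scope.
Local Open Scope ring_scope.

Lemma giant_component_eventually (R : realType) (eps L : R) (q : nat) :
  0 < eps -> eps <= 1 / 10 -> 4 <= L ->
  100 / eps ^+ 2 * (L + 1) ^+ 2 <= expR (eps / 16 * L) ->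
  (3 / 2 + 5 * eps) * (expR L / L) <= q%:R ->
  \forall n \near \oo, 1 - 14 / n%:R <=
    prob_Gnm R n (Num.truncn (expR L * n%:R / 2)) (giant_component q (0 : R)).
Proof.
have arith (r l : nat) : [/\ (r.+2 <= r.*2 + l.+4)%N, (r <= r.*2 + l.+2)%N &
    ((r.*2 + l.+2).+2 <= r.*2 + l.+4)%N] by split; lia.
move=> e0 e1 L4 hL hq.
have [r [l [r0 rlq ra rld lg]]] := palette_sizes_exist e0 e1 L4 hL hq.
have [rl1 rl2 rl3] := arith r l.
have sub_exp := subset_exponent e0 e1 L4 hL lg.
have Lam0 : 0 <= eps / 8 * L.
  by rewrite mulr_ge0 ?divr_ge0 ?(ltW e0) //; apply: le_trans L4.
have d0 : 0 < expR L := expR_gt0 _.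
near=> n.
have nd : expR L + 2 <= n%:R by near: n; exact: nbhs_infty_ger.
have ne : (1 + eps / 2) * (1 + expR L) / (eps / 2) <= n%:R.
  by near: n; exact: nbhs_infty_ger.
have [N0 mN pd] := edge_density (ltW d0) nd.
set m := Num.truncn _ in mN pd *.
have [ptau pd2] := density_bounds d0 e0 nd ne pd.
set tau := _ / n%:R in ptau.
have n0 : (0 < n)%N by case: (n) N0.
have nR : 0 < n%:R :> R by rewrite ltr0n.
have tau0 : 0 <= tau.
  by rewrite divr_ge0 // mulr_ge0 ?(ltW d0) // addr_ge0 // divr_ge0 // ltW.
(* The integer part plus one: [b] exceeds the threshold, which no smaller integer does. *)
have [b bb bs] : exists2 b : nat, n%:R * expR (- (eps / 8 * L)) < b%:R &
    forall s, (s < b)%N -> s%:R <= n%:R * expR (- (eps / 8 * L)).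
  have bn0 : 0 <= n%:R * expR (- (eps / 8 * L)) by rewrite mulr_ge0 ?expR_ge0.
  have /andP[ba bb] := truncn_itv bn0.
  exists (Num.truncn (n%:R * expR (- (eps / 8 * L)))).+1 => // s.
  by rewrite ltnS -(ler_nat R) => /le_trans; apply.
have part r1 a : (r <= r1)%N -> (r1.+2 <= r.*2 + l.+4)%N ->
    2 * r%:R * a%:R <= r1%:R * n%:R :> R ->
    prob_Gnm R n m (bad_partition r1 a b) <= 6 / n%:R.
  move=> rr1 r1l ar; have r10 : (0 < r1)%N by apply: leq_trans rr1.
  apply: (bad_partition_small N0 mN r10 tau0 ptau).
  apply: (partition_exponent e0 e1 L4 hL n0 rr1 ra _ ar) => //.
  by apply: le_trans rld; rewrite ler_nat.
have part1 : prob_Gnm R n m (bad_partition r n./2 b) <= 6 / n%:R.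
  apply: part => //.
  rewrite mulrAC mulrC ler_wpM2l //.
  by rewrite -natrM ler_nat mul2n -[X in (_ <= X)%N]odd_double_half leq_addl.
have part2 : prob_Gnm R n m (bad_partition (r.*2 + l.+2) n b) <= 6 / n%:R.
  by apply: part => //; rewrite ler_wpM2r // natrD -mul2n natrM lerDl.
have sub := bad_subset_small N0 mN pd2 (ltW d0) Lam0 bs sub_exp.
have good (E : {set {set 'I_n}}) : E \in graphs n m ->
    ~~ bad_partition r n./2 b E -> ~~ bad_partition (r.*2 + l.+2) n b E ->
    ~~ bad_subset l b E -> giant_component q (0 : R) E.
  by move=> EG g1 g2 g3; apply: connected_giant_component EG g1 g2 g3 rlq.
apply: le_trans (prob_Gnm_union R mN good).
have -> : 14 / n%:R = 6 / n%:R + 6 / n%:R + 2 / n%:R :> R by field; rewrite lt0r_neq0.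
by rewrite lerD2l lerN2; apply: lerD => //; apply: lerD.
Unshelve. all: by end_near. Qed.

Theorem theorem1 (R : realType) (c : R) (hc : 3 / 2 < c) :
  exists d0 : R, forall d : R, d0 <= d ->
  forall q : nat, c * d / ln d <= q%:R ->
  exists eps : nat -> R,
    eps n @[n --> \oo] --> (0 : R) /\
    prob_Gnm R n (Num.truncn (d * n%:R / 2)) (giant_component q (eps n))
      @[n --> \oo] --> (1 : R).
Proof.
(* The second bound gives [3/2 + 5 e <= c], so the assumption on [q] implies the one used above. *)
pose e := Num.min (1 / 10) ((c - 3 / 2) / 5).
have e0 : 0 < e by rewrite lt_min; apply/andP; split; lra.
have [e1 ec] : e <= 1 / 10 /\ e <= (c - 3 / 2) / 5.
  by split; rewrite ge_min lexx ?orbT.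
have [L0 L04 hL0] : exists2 L0 : R, 4 <= L0 &
    forall L, L0 <= L -> 100 / e ^+ 2 * (L + 1) ^+ 2 <= expR (e / 16 * L).
  by apply: expR_dominates_square; apply: divr_gt0; rewrite ?exprn_gt0 //; lra.
(* The error is 0 since all colourings lie in one component; [d >= expR L0] gives [ln d >= L0]. *)
exists (expR L0) => d hd q hq; exists (fun=> 0); split; first exact: cvg_cst.
have d0 : 0 < d by apply: lt_le_trans hd; apply: expR_gt0.
have L0d : L0 <= ln d by rewrite -(expRK L0) ler_ln ?posrE ?expR_gt0.
have L4 : 4 <= ln d by apply: le_trans L0d.
have hq' : (3 / 2 + 5 * e) * (expR (ln d) / ln d) <= q%:R.
  apply: le_trans hq; rewrite lnK // -mulrA ler_wpM2r ?divr_ge0 ?(ltW d0) //; lra.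
have := giant_component_eventually e0 e1 L4 (hL0 _ L0d) hq'.
rewrite lnK // => ev.
apply: (@squeeze_cvgr _ \oo _ _ (fun n : nat => 1 - 14 / n%:R) (fun=> 1)).
- near=> n; apply/andP; split; first by near: n.
  (* If there are no graphs, the quotient is 0 by the convention for division, hence still at most
     1. *)
  have [G0|G0] := posnP #|graphs n (Num.truncn (d * n%:R / 2))|.
    by rewrite /prob_Gnm G0 invr0 mulr0.
  rewrite /prob_Gnm ler_pdivrMr ?ltr0n // mul1r ler_nat subset_leq_card //.
  by apply/fintype.subsetP => E; rewrite inE => /andP[].
- rewrite -[X in _ --> X](subr0 (1 : R)); apply: cvgB; first exact: cvg_cst.
  rewrite -(mulr0 (14 : R)); apply: cvgMr.
  rewrite -(cvg_shiftn 1); under eq_fun do rewrite addn1.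
  exact: cvg_harmonic.
- exact: cvg_cst.
Unshelve. all: by end_near. Qed.
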